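(* Let $V=\{v_1,v_2,v_3,v_4\}\subset\mathbb{R}^3$ be the set of vertices of a (non-degenerate) tetrahedron $T=\mathrm{co}(V)$ with circumradius $r(V)$, and let $R^*=r_L(V)$. Then $$\mathrm{co}_\rho(V)=V\quad\text{for } \rho<R^*,\qquad \mathrm{co}_\rho(V)=V\cup\tilde\Gamma\quad\text{for }\rho>R^*,$$ where, for $\rho>R^*$, $$\tilde\Gamma=\mathrm{int}(T)\setminus\bigcup_{i=1}^4B_i(\rho)$$ is a connected, non-empty set whose boundary $\partial\tilde\Gamma$ is the union of connected subsets of the spheres $\partial B_i(\rho)$, $1\le i\le 4$. For $\rho=R^*$: $$\mathrm{co}_{R^*}(V)=V\cup\{O^*\}\quad\text{if } r_L(V)>r(V),\qquad \mathrm{co}_{R^*}(V)=V\quad\text{if } r_L(V)=r(V),$$ where, in the case $r_L(V)>r(V)$, $O^*$ is the point of $\mathrm{int}(T)$ common to the four spheres $\partial B_i(R^* )$, $1\le i\le 4$.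
   Context: For a non-empty closed set $E\subset\mathbb{R}^3$ and $\rho>0$, the $\rho$-hulloid of $E$ is $\mathrm{co}_\rho(E)=\bigcap B^c$, the intersection over all open balls $B$ of radius $\rho$ with $B\cap E=\emptyset$ (equal to $\mathbb{R}^3$ if there are no such balls). The circumradius $r(V)$ is the radius of the unique sphere containing $V$. The $\rho$-hulloid of $V$ is called full if $\mathrm{int}(\mathrm{co}_\rho(V))\neq\emptyset$, and $r_L(V)=\inf\{\rho>r(V):\ \mathrm{co}_\rho(V)\text{ is full}\}$. For $\rho>r(V)$ and $1\le i\le4$, $B_i(\rho)$ denotes the unique open ball of radius $\rho$ such that $V\setminus\{v_i\}\subset\partial B_i(\rho)$ and $v_i\notin B_i(\rho)$. It is known that when $r_L(V)>r(V)$ there is a point $O^*\in\mathrm{int}(T)$ lying on all four spheres $\partial B_i(r_L(V))$. *)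

(* Defs.v *)
From mathcomp Require Export all_boot all_order all_algebra.
From mathcomp Require Export all_classical all_reals all_analysis.
Export Order.TTheory GRing.Theory Num.Theory.
Export numFieldNormedType.Exports.

Set Implicit Arguments.
Unset Strict Implicit.
Unset Printing Implicit Defensive.

Local Open Scope classical_set_scope.
Local Open Scope ring_scope.

(* The library norm `|x| on 'rV[R]_n is the sup norm (it induces the usual
   topology, which is the one used for interior, closure and connected below);
   balls and spheres have to be Euclidean. *)
Definition enorm (R : realType) (n : nat) (x : 'rV[R]_n) : R :=
  Num.sqrt (\sum_(i < n) x 0 i ^+ 2).

Definition eball (R : realType) (n : nat) (c : 'rV[R]_n) (rho : R) :
    set 'rV[R]_n :=
  [set x | enorm (x - c) < rho].

Definition esphere (R : realType) (n : nat) (c : 'rV[R]_n) (rho : R) :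
    set 'rV[R]_n :=
  [set x | enorm (x - c) = rho].

Definition boundary (T : topologicalType) (A : set T) : set T :=
  closure A `\` interior A.

Definition convex_hull (R : realType) (n : nat) (A : set 'rV[R]_n) :
    set 'rV[R]_n :=
  smallest (@convex_set R 'rV[R]_n) A.

Definition hulloid (R : realType) (n : nat) (rho : R) (E : set 'rV[R]_n) :
    set 'rV[R]_n :=
  \bigcap_(c in [set c | eball c rho `&` E = set0]) ~` eball c rho.

Definition hulloid_full (R : realType) (n : nat) (rho : R)
    (E : set 'rV[R]_n) : Prop :=
  interior (hulloid rho E) !=set0.

(* [xget] is used as a definite description: for a non-degenerate simplex
   exactly one sphere contains its vertices. *)
Definition circumradius (R : realType) (n : nat) (V : set 'rV[R]_n) : R :=
  xget 0 [set r | exists c, V `<=` esphere c r].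

(* [inf] is the real-valued infimum (0 by convention on the empty set); for the
   vertices of a tetrahedron the set is non-empty and bounded below. *)
Definition full_radius (R : realType) (n : nat) (V : set 'rV[R]_n) : R :=
  inf [set rho | circumradius V < rho /\ hulloid_full rho V].

Definition nondegenerate_tetrahedron (R : realType) (v : 'I_4 -> 'rV[R]_3) :
    Prop :=
  row_free (\matrix_(i < 3) (v (lift ord0 i) - v ord0)).

(* Definite description again: if [v] is non-degenerate and
   [rho > circumradius (range v)], exactly one centre qualifies. *)
Definition opp_center (R : realType) (v : 'I_4 -> 'rV[R]_3) (rho : R)
    (i : 'I_4) : 'rV[R]_3 :=
  xget 0 [set c | range v `\ v i `<=` esphere c rho /\ ~ eball c rho (v i)].

Definition opp_ball (R : realType) (v : 'I_4 -> 'rV[R]_3) (rho : R)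
    (i : 'I_4) : set 'rV[R]_3 :=
  eball (opp_center v rho i) rho.

Definition opp_sphere (R : realType) (v : 'I_4 -> 'rV[R]_3) (rho : R)
    (i : 'I_4) : set 'rV[R]_3 :=
  esphere (opp_center v rho i) rho.

Definition tetra_core (R : realType) (v : 'I_4 -> 'rV[R]_3) (rho : R) :
    set 'rV[R]_3 :=
  interior (convex_hull (range v)) `\` \bigcup_i opp_ball v rho i.

(* Main.v *)
Require Import Defs.
From mathcomp Require Import ring lra.

Set Implicit Arguments.
Unset Strict Implicit.
Unset Printing Implicit Defensive.

Local Open Scope classical_set_scope.
Local Open Scope ring_scope.

(** Let [c0], [r] be the circumcentre and circumradius, [lam j] the barycentric
    coordinates and [W x = r^2 - |x - c0|^2].  For [rho > r] the power of [x]
    with respect to the sphere of [B_j(rho)] is [K_j lam_j(x) - W x], where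
    [K_j > 0] is continuous, strictly increasing and unbounded in [rho].  Hence
    a point [x] of the interior of [T] lies outside all four balls iff its
    coordinates [y_j = lam_j(x) / W x] satisfy [y_j >= A_j := 1 / K_j].  In these
    coordinates the interior of [T] is the part [y > 0] of the quadric [F = 0],
    where [F] is a quadratic function whose gradient has positive entries at
    every point of that part, and which is convex in each direction [z >= 0].
    So the core is empty, a single point, or has interior points according to
    whether [F A] is positive, zero or negative, and for [F A < 0] the rays from
    [A] parametrise it: it is path-connected, and so are its faces
    [y_i = A_i]. *)

(** * Euclidean norm and hulloids *)

Section Dot.
Variables (R : realType) (n : nat).
Implicit Types (x y z : 'rV[R]_n) (a : R).

Definition dot x y : R := \sum_(i < n) x 0 i * y 0 i.
Definition sqn x : R := dot x x.

Lemma dotC x y : dot x y = dot y x.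
Proof. by apply: eq_bigr => i _; rewrite mulrC. Qed.

Lemma dotDl x y z : dot (x + y) z = dot x z + dot y z.
Proof.
by rewrite /dot -big_split; apply: eq_bigr => i _; rewrite mxE mulrDl.
Qed.

Lemma dotZl a x y : dot (a *: x) y = a * dot x y.
Proof. by rewrite /dot mulr_sumr; apply: eq_bigr => i _; rewrite mxE mulrA. Qed.

Lemma dotNl x y : dot (- x) y = - dot x y.
Proof. by rewrite -scaleN1r dotZl mulN1r. Qed.

Lemma dotBl x y z : dot (x - y) z = dot x z - dot y z.
Proof. by rewrite dotDl dotNl. Qed.

Lemma dot0l y : dot 0 y = 0.
Proof. by rewrite -(scale0r y) dotZl mul0r. Qed.

Lemma dotDr x y z : dot x (y + z) = dot x y + dot x z.
Proof. by rewrite dotC dotDl !(dotC x). Qed.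

Lemma dotZr a x y : dot x (a *: y) = a * dot x y.
Proof. by rewrite dotC dotZl dotC. Qed.

Lemma dotNr x y : dot x (- y) = - dot x y.
Proof. by rewrite dotC dotNl dotC. Qed.

Lemma dotBr x y z : dot x (y - z) = dot x y - dot x z.
Proof. by rewrite dotDr dotNr. Qed.

Lemma dot_suml (I : finType) (F : I -> 'rV[R]_n) y :
  dot (\sum_i F i) y = \sum_i dot (F i) y.
Proof.
by apply: (big_morph (dot^~ y)); [move=> ? ?; exact: dotDl|exact: dot0l].
Qed.

Lemma dot_sumr (I : finType) x (F : I -> 'rV[R]_n) :
  dot x (\sum_i F i) = \sum_i dot x (F i).
Proof. by rewrite dotC dot_suml; apply: eq_bigr => i _; rewrite dotC. Qed.

Lemma dot_eq x y : (forall z, dot z x = dot z y) -> x = y.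
Proof.
move=> e; apply/rowP => i; have := e (delta_mx 0 i).
by rewrite /dot (bigD1 i)//= [in RHS](bigD1 i)//= !mxE !eqxx !mul1r
  !big1 ?addr0// => j ji; rewrite !mxE (negPf ji) mul0r.
Qed.

Lemma sqnD x y : sqn (x + y) = sqn x + 2 * dot x y + sqn y.
Proof. by rewrite /sqn dotDl !dotDr (dotC y x); ring. Qed.

Lemma sqnZ a x : sqn (a *: x) = a ^+ 2 * sqn x.
Proof. by rewrite /sqn dotZl dotZr mulrA. Qed.

Lemma sqnN x : sqn (- x) = sqn x.
Proof. by rewrite -scaleN1r sqnZ; ring. Qed.

Lemma sqnB x y : sqn (x - y) = sqn x - 2 * dot x y + sqn y.
Proof. by rewrite sqnD dotNr sqnN; ring. Qed.

Lemma sqn0 : sqn 0 = 0. Proof. exact: dot0l. Qed.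

Lemma sqn_ge0 x : 0 <= sqn x.
Proof. by apply: sumr_ge0 => i _; rewrite -expr2 sqr_ge0. Qed.

Lemma sqn_eq0 x : sqn x = 0 -> x = 0.
Proof.
move/eqP; rewrite psumr_eq0 => [/allP e|i _]; last by rewrite -expr2 sqr_ge0.
apply/rowP => i; rewrite mxE; apply/eqP.
by have := e i (mem_index_enum i); rewrite -expr2 sqrf_eq0.
Qed.

Lemma sqn_gt0 x : x != 0 -> 0 < sqn x.
Proof.
move=> x0; rewrite lt_neqAle sqn_ge0 andbT eq_sym.
by apply: contraNN x0 => /eqP/sqn_eq0 ->.
Qed.

Lemma enormE x : enorm x = Num.sqrt (sqn x).
Proof. by congr Num.sqrt; apply: eq_bigr => i _; rewrite expr2. Qed.

Lemma enorm_lt x a : 0 < a -> (enorm x < a) = (sqn x < a ^+ 2).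
Proof.
by move=> a0; rewrite enormE -{1}(gtr0_norm a0) -sqrtr_sqr ltr_sqrt// exprn_gt0.
Qed.

Lemma enorm_eq x a : 0 <= a -> (enorm x = a) <-> (sqn x = a ^+ 2).
Proof.
move=> a0; rewrite enormE; split => [<-|->]; first by rewrite sqr_sqrtr ?sqn_ge0.
by rewrite sqrtr_sqr ger0_norm.
Qed.

Lemma eballP c a x : 0 < a -> eball c a x <-> sqn (x - c) < a ^+ 2.
Proof. by move=> a0; rewrite /eball /= enorm_lt. Qed.

Lemma sum_sqn_sub (I : finType) (w : I -> R) (F : I -> 'rV[R]_n) x :
  \sum_i w i * sqn (F i - x) =
  \sum_i w i * sqn (F i) - 2 * dot (\sum_i w i *: F i) x + (\sum_i w i) * sqn x.
Proof.
rewrite dot_suml mulr_suml mulr_sumr -sumrB -big_split; apply: eq_bigr => i _ /=.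
by rewrite sqnB dotZl; ring.
Qed.

(** The weighted variance about the barycentre is nonnegative. The weights are not normalised, so a
    zero total is treated apart. *)
Lemma sqn_jensen (I : finType) (w : I -> R) (F : I -> 'rV[R]_n) :
  (forall i, 0 <= w i) ->
  sqn (\sum_i w i *: F i) <= (\sum_i w i) * \sum_i w i * sqn (F i).
Proof.
move=> w0; set S := \sum_i w i.
have S0 : 0 <= S by apply: sumr_ge0.
have [S_eq0|Sn0] := eqVneq S 0.
  have wi0 i : w i = 0.
    by have := psumr_eq0P (fun i _ => w0 i) S_eq0; apply.
  by rewrite big1 ?sqn0 ?S_eq0 ?mul0r// => i _; rewrite wi0 scale0r.
have Sp : 0 < S by rewrite lt_neqAle eq_sym Sn0.
have : 0 <= \sum_i w i * sqn (F i - S^-1 *: \sum_i w i *: F i).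
  by apply: sumr_ge0 => i _; rewrite mulr_ge0 ?sqn_ge0.
rewrite sum_sqn_sub -/S dotZr sqnZ -/(sqn _) => h.
rewrite -subr_ge0 -(pmulr_rge0 _ (_ : 0 < S^-1)) ?invr_gt0//.
by apply: le_trans h _; rewrite le_eqVlt; apply/orP; left; apply/eqP; field.
Qed.

Lemma sqn_conv x y a : 0 <= a -> a <= 1 ->
  sqn (a *: x + (1 - a) *: y) <= a * sqn x + (1 - a) * sqn y.
Proof.
move=> a0 a1; have := sqn_ge0 (x - y).
rewrite sqnB sqnD !sqnZ dotZl dotZr => h.
have : 0 <= a * (1 - a) by rewrite mulr_ge0 ?subr_ge0.
by move: h; set X := sqn x; set Y := sqn y; set D := dot x y => *; nra.
Qed.

End Dot.

(** * Continuity of the Euclidean structure, and growth of the hulloid with the radius *)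

Section DotTopology.
Variables (R : realType) (n : nat).

Lemma cvg_sumr {T : Type} {F : set_system T} {FF : Filter F} (V : normedModType R)
    (I : finType) (f : I -> T -> V) (l : I -> V) :
  (forall i, f i x @[x --> F] --> l i) ->
  \sum_i f i x @[x --> F] --> \sum_i l i.
Proof. by move=> h; apply: cvg_big => // x; exact: add_continuous. Qed.

Lemma dot_cvg {T : Type} {F : set_system T} {FF : Filter F}
    (f g : T -> 'rV[R]_n) (a b : 'rV[R]_n) :
  f x @[x --> F] --> a -> g x @[x --> F] --> b ->
  dot (f x) (g x) @[x --> F] --> dot a b.
Proof.
move=> fa gb; apply: (@cvg_sumr _ _ _ R^o) => i.
have cc (h : T -> 'rV[R]_n) (c : 'rV[R]_n) : h x @[x --> F] --> c -> h x 0 i @[x --> F] --> c 0 i.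
  by move=> hc; apply: (cvg_comp h (fun M => M 0 i) hc); exact: coord_continuous.
by apply: cvgM; exact: cc.
Qed.

Lemma line_continuous (x w : 'rV[R]_n) : continuous (fun t : R => x + t *: w).
Proof.
move=> t; apply: (@cvgD _ _ _ (nbhs t) _ (cst x) (fun t => t *: w)).
  exact: cvg_cst.
by apply: (@cvgZ _ _ _ (nbhs t) _ id (cst w)); [exact: cvg_id|exact: cvg_cst].
Qed.

Lemma near_line (x w : 'rV[R]_n) (P : set 'rV[R]_n) :
  (\forall y \near x, P y) -> \forall t \near (0 : R)^'+, P (x + t *: w).
Proof.
move=> xP; have := cvg_at_right_filter (@line_continuous x w 0).
by rewrite scale0r addr0; apply.
Qed.

Lemma sqn_sub_continuous (c : 'rV[R]_n) : continuous (fun x : 'rV[R]_n => sqn (x - c)).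
Proof.
move=> x; have h : y - c @[y --> x] --> x - c.
  by apply: (@cvgB _ _ _ (nbhs x) _ id (cst c) x c); [exact: cvg_id|exact: cvg_cst].
exact: (dot_cvg h h).
Qed.

Lemma open_eball (c : 'rV[R]_n) (a : R) : open (eball c a).
Proof.
have -> : eball c a = (fun x : 'rV[R]_n => Num.sqrt (sqn (x - c))) @^-1` [set z | z < a].
  by apply/seteqP; split => x; rewrite /eball /= enormE.
apply: open_comp; last exact: open_lt.
by move=> x _; apply: continuous_comp; [exact: sqn_sub_continuous|exact: sqrt_continuous].
Qed.

Lemma closed_hulloid (a : R) (E : set 'rV[R]_n) : closed (hulloid a E).
Proof. by apply: closed_bigI => c _; apply: open_closedC; exact: open_eball. Qed.

Lemma closed_esphere (c : 'rV[R]_n) (a : R) : closed (esphere c a).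
Proof.
have -> : esphere c a = (fun x : 'rV[R]_n => Num.sqrt (sqn (x - c))) @^-1` [set z | z = a].
  by apply/seteqP; split => x; rewrite /esphere /= enormE.
apply: closed_comp; last exact: closed_eq.
by move=> x _; apply: continuous_comp; [exact: sqn_sub_continuous|exact: sqrt_continuous].
Qed.

Lemma hulloidP (a : R) (E : set 'rV[R]_n) x : 0 < a ->
  hulloid a E x <-> forall c, (forall e, E e -> a ^+ 2 <= sqn (e - c)) ->
                     a ^+ 2 <= sqn (x - c).
Proof.
move=> a0; split=> [h c hc|h c /= hc].
  rewrite leNgt; apply/negP => xc; apply: (h c) => /=; last by apply/eballP.
  apply/seteqP; split => // e [/(eballP _ _ a0) ec Ee].
  by have := hc e Ee; rewrite leNgt ec.
move=> /(eballP _ _ a0); apply/negP; rewrite -leNgt; apply: h => e Ee.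
rewrite leNgt; apply/negP => ec; have : (eball c a `&` E) e by split => //; apply/eballP.
by rewrite hc.
Qed.

Lemma sub_hulloid (a : R) (E : set 'rV[R]_n) : 0 < a -> E `<=` hulloid a E.
Proof. by move=> a0 x Ex; apply/hulloidP => // c; apply. Qed.

(* The ball of radius [a] internally homothetic to a ball of radius [b], with
   centre of homothety [x], lies in that ball and contains [x] as well. *)
Lemma hulloid_le (a b : R) (E : set 'rV[R]_n) : 0 < a -> a <= b ->
  hulloid a E `<=` hulloid b E.
Proof.
move=> a0 ab x; have b0 : 0 < b by apply: lt_le_trans ab.
move=> /(hulloidP _ _ a0) h; apply/hulloidP => // c hc.
rewrite leNgt; apply/negP => xc.
pose t := a / b; have t0 : 0 < t by rewrite divr_gt0.
have t1 : t <= 1 by rewrite ler_pdivrMr ?mul1r.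
have at_ : a = t * b by rewrite mulfVK ?gt_eqF.
clearbody t.
have ca : c + (1 - t) *: (x - c) = x - t *: (x - c).
  by rewrite scalerBl scale1r addrCA addrA subrK.
have xin : sqn (x - (c + (1 - t) *: (x - c))) < a ^+ 2.
  by rewrite ca subKr sqnZ at_ exprMn ltr_pM2l ?exprn_gt0.
suff : a ^+ 2 <= sqn (x - (c + (1 - t) *: (x - c))) by rewrite leNgt xin.
apply: h => e Ee; rewrite leNgt; apply/negP => ein.
suff : sqn (e - c) < b ^+ 2 by rewrite ltNge hc.
have -> : e - c = t *: (t^-1 *: (e - (c + (1 - t) *: (x - c)))) + (1 - t) *: (x - c).
  by rewrite scalerA mulfV ?gt_eqF// scale1r opprD addrA subrK.
apply: le_lt_trans (sqn_conv _ _ (ltW t0) t1) _.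
have tp : sqn (t^-1 *: (e - (c + (1 - t) *: (x - c)))) < b ^+ 2.
  rewrite sqnZ -ltr_pdivlMl ?exprn_gt0 ?invr_gt0// -exprVn invrK mulrC -exprMn.
  by rewrite mulrC -at_.
have e2 : b ^+ 2 = t * b ^+ 2 + (1 - t) * b ^+ 2 by ring.
rewrite [ltRHS]e2.
by rewrite ltr_leD ?ltr_pM2l// ler_wpM2l ?subr_ge0// ltW.
Qed.
End DotTopology.

(** * Barycentric coordinates and the circumscribed sphere *)

Lemma convex_set_sum (R : realType) (n : nat) (A : set 'rV[R]_n) (m : nat)
    (w : 'I_m.+1 -> R) (p : 'I_m.+1 -> 'rV[R]_n) :
  convex_set (A : set (convex_lmodType 'rV[R]_n)) ->
  (forall i, 0 <= w i) -> \sum_i w i = 1 -> (forall i, A (p i)) ->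
  A (\sum_i w i *: p i).
Proof.
move=> cA; elim: m w p => [|m IH] w p w0 w1 pA.
  rewrite big_ord_recl big_ord0 addr0 in w1.
  by rewrite big_ord_recl big_ord0 addr0 w1 scale1r.
rewrite big_ord_recl in w1; rewrite big_ord_recl.
set s := \sum_(i < m.+1) w (lift ord0 i) in w1.
have s0 : 0 <= s by apply: sumr_ge0.
have wE : w ord0 = 1 - s by rewrite -w1 addrK.
have [s_eq0|sn0] := eqVneq s 0.
  have z i : w (lift ord0 i) = 0.
    by have := psumr_eq0P (fun i _ => w0 (lift ord0 i)) s_eq0; apply.
  by rewrite wE s_eq0 subr0 scale1r big1 ?addr0// => i _; rewrite z scale0r.
have h0 : 0 <= w ord0 by [].
have h1 : w ord0 <= 1 by rewrite wE lerBlDr lerDl.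
have /= := cA (p ord0) (\sum_(i < m.+1) (w (lift ord0 i) / s) *: p (lift ord0 i))
  (Itv01 h0 h1).
rewrite !inE => /(_ (pA _)) H.
suff -> : \sum_(i < m.+1) w (lift ord0 i) *: p (lift ord0 i) =
   (1 - w ord0) *: \sum_(i < m.+1) (w (lift ord0 i) / s) *: p (lift ord0 i).
  apply: H; apply: IH => // [i|]; first by rewrite divr_ge0.
  by rewrite -mulr_suml -/s divff.
rewrite wE subKr scaler_sumr; apply: eq_bigr => i _.
by rewrite scalerA mulrCA divff// mulr1.
Qed.

Section Barycentric.
Variables (R : realType) (v : 'I_4 -> 'rV[R]_3).
Hypothesis hv : nondegenerate_tetrahedron v.

Let M := \matrix_(i < 3) (v (lift ord0 i) - v ord0).

Let Munit : M \in unitmx. Proof. by rewrite -row_free_unit. Qed.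

Let N : 'M[R]_3 := invmx M.

(** Gradient of the [j]-th barycentric coordinate: a column of the inverse edge matrix, or minus the
    sum of the columns for [ord0], as the coordinates add up to 1. *)
Definition bgrad (j : 'I_4) : 'rV[R]_3 :=
  let g i := (col i (invmx (\matrix_(i < 3) (v (lift ord0 i) - v ord0))))^T in
  if unlift ord0 j is Some i then g i else - \sum_i g i.

Definition bary (j : 'I_4) (x : 'rV[R]_3) : R :=
  (j == ord0)%:R + dot (bgrad j) (x - v ord0).

Lemma baryB j x y : bary j x - bary j y = dot (bgrad j) (x - y).
Proof. by rewrite /bary opprD addrACA subrr add0r -dotBr opprB addrA subrK. Qed.

Lemma bgrad_lift i : bgrad (lift ord0 i) = (col i N)^T.
Proof. by rewrite /bgrad liftK. Qed.

Lemma bgrad0 : bgrad ord0 = - \sum_i bgrad (lift ord0 i).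
Proof.
rewrite {1}/bgrad unlift_none; congr (- _).
by apply: eq_bigr => i _; rewrite bgrad_lift.
Qed.

Lemma sum_bgrad : \sum_j bgrad j = 0.
Proof. by rewrite big_ord_recl bgrad0 addNr. Qed.

Lemma sum_bary x : \sum_j bary j x = 1.
Proof.
rewrite big_split /= -dot_suml sum_bgrad dot0l addr0.
by rewrite big_ord_recl eqxx big1 ?addr0.
Qed.

Lemma dot_bgrad_lift x i : dot (bgrad (lift ord0 i)) x = (x *m N) 0 i.
Proof.
by rewrite bgrad_lift mxE; apply: eq_bigr => k _; rewrite !mxE mulrC.
Qed.

Lemma bary_sum x : \sum_j bary j x *: v j = x.
Proof.
have -> : \sum_j bary j x *: v j = v ord0 + \sum_j bary j x *: (v j - v ord0).
  under [in RHS]eq_bigr do rewrite scalerBr.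
  by rewrite sumrB -scaler_suml sum_bary scale1r subrKC.
rewrite big_ord_recl subrr scaler0 add0r.
rewrite -[RHS](subrKC (v ord0)) -[in RHS](mulmx1 (x - v ord0)).
rewrite -(mulVmx Munit) mulmxA; congr (_ + _).
apply/rowP => k; rewrite summxE mxE; apply: eq_bigr => i _.
rewrite [LHS]mxE /bary dot_bgrad_lift [(lift ord0 i == ord0)%:R]/= add0r; congr (_ * _).
by rewrite [in RHS]mxE.
Qed.

Lemma bary_vertex j k : bary j (v k) = (j == k)%:R.
Proof.
have lk i k' : bary (lift ord0 i) (v k') = (lift ord0 i == k')%:R.
  rewrite /bary dot_bgrad_lift /= add0r.
  case: (unliftP ord0 k') => [k''|] ->; last by rewrite subrr mul0mx mxE.
  have -> : v (lift ord0 k'') - v ord0 = row k'' M by rewrite rowK.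
  by rewrite -row_mul mulmxV// !mxE eq_sym (inj_eq lift_inj).
case: (unliftP ord0 j) => [i|] ->; first exact: lk.
have := sum_bary (v k); rewrite big_ord_recl => /esym/eqP; rewrite -subr_eq.
move=> /eqP <-; rewrite (eq_bigr (fun i => (lift ord0 i == k)%:R)); last by move=> i _; exact: lk.
case: (unliftP ord0 k) => [k''|] ->.
  rewrite (bigD1 k'')//= eqxx big1 ?addr0 ?subrr// => i ik.
  by rewrite (inj_eq lift_inj) (negPf ik).
by rewrite big1 ?subr0.
Qed.

Lemma bary_comb (w : 'I_4 -> R) j : \sum_k w k = 1 ->
  bary j (\sum_k w k *: v k) = w j.
Proof.
move=> w1.
have -> : \sum_k w k *: v k = \sum_k w k *: (v k - v ord0) + v ord0.
  under [in RHS]eq_bigr do rewrite scalerBr.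
  by rewrite sumrB -scaler_suml w1 scale1r subrK.
rewrite /bary addrK dot_sumr.
under eq_bigr do rewrite dotZr -baryB !bary_vertex mulrBr.
rewrite sumrB -mulr_suml w1 mul1r addrC subrK.
rewrite (bigD1 j)//= eqxx mulr1 big1 ?addr0// => k kj.
by rewrite eq_sym (negPf kj) mulr0.
Qed.

Lemma vertex_inj : injective v.
Proof.
move=> i j e; have := bary_vertex i j; rewrite -e bary_vertex eqxx.
by case: eqVneq => // _ /eqP; rewrite oner_eq0.
Qed.

Lemma bgrad_neq0 j : bgrad j != 0.
Proof.
apply/eqP => g0; pose k : 'I_4 := if j == ord0 then ord_max else ord0.
have kj : j != k by rewrite /k; case: ifP => [/eqP ->|/negbT].
have := baryB j (v j) (v k); rewrite g0 dot0l !bary_vertex eqxx (negPf kj) subr0.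
by move/eqP; rewrite oner_eq0.
Qed.

Lemma bary_continuous j : continuous (bary j).
Proof.
move=> x; apply: (@cvgD _ R^o _ (nbhs x) _ (cst _)
  (fun x => dot (bgrad j) (x - v ord0))); first exact: cvg_cst.
apply: (@dot_cvg _ _ _ _ _ (cst (bgrad j)) (fun x => x - v ord0)); first exact: cvg_cst.
by apply: (@cvgB _ _ _ (nbhs x) _ id (cst (v ord0))); [exact: cvg_id|exact: cvg_cst].
Qed.

Lemma convex_hullE : convex_hull (range v) = [set x | forall j, 0 <= bary j x].
Proof.
apply/seteqP; split => x /=.
  move=> /(_ [set x | forall j, 0 <= bary j x]); apply; split.
    move=> y z l; rewrite !inE => hy hz j.
    change (0 <= bary j (l%:inum *: y + (1 - l%:inum) *: z)).
    have -> : bary j (l%:inum *: y + (1 - l%:inum) *: z) =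
              l%:inum * bary j y + (1 - l%:inum) * bary j z.
      have := baryB j (l%:inum *: y + (1 - l%:inum) *: z) z.
      have -> : l%:inum *: y + (1 - l%:inum) *: z - z = l%:inum *: (y - z).
        by rewrite scalerBl scale1r scalerBr [_ + (z - _)]addrC addrAC
          [z - _ - z]addrAC subrr add0r addrC.
      by rewrite dotZr -baryB => /eqP; rewrite subr_eq => /eqP ->; ring.
    by rewrite addr_ge0 ?mulr_ge0// subr_ge0.
  by move=> _ [k _ <-] j; rewrite bary_vertex ler0n.
move=> hx A [cA vA]; rewrite -(bary_sum x).
apply: convex_set_sum => //; first exact: sum_bary.
by move=> i; apply: vA; exists i.
Qed.

Lemma interior_convex_hull :
  interior (convex_hull (range v)) = [set x | forall j, 0 < bary j x].
Proof.
rewrite convex_hullE; apply/seteqP; split => x /=.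
  move=> xi j; rewrite ltNge; apply/negP => xj.
  (* Moving along [v k - v j] lowers [bary j] at unit rate, so a point with [bary j x <= 0] leaves
     the hull at once. *)
  pose k : 'I_4 := if j == ord0 then ord_max else ord0.
  have kj : j != k by rewrite /k; case: ifP => [/eqP ->|/negbT].
  have nl := @near_line _ _ x (v k - v j) [set x | forall j, 0 <= bary j x] xi.
  have [t [t0]] : exists t : R, 0 < t /\ (forall i, 0 <= bary i (x + t *: (v k - v j))).
    near (0 : R)^'+ => t; exists t; split => //.
    by near: t; exact: nl.
  move=> /(_ j); rewrite leNgt; apply/negP; rewrite negbK.
  have := baryB j (x + t *: (v k - v j)) x; rewrite [x + _ - x]addrC addKr dotZr -baryB.
  rewrite !bary_vertex eqxx (negPf kj) sub0r mulrN1 => e; lra.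
move=> hx; rewrite /interior /=.
suff : \forall y \near x, forall j, 0 < bary j y.
  by apply: filterS => y hy j; exact: ltW.
have nb j : \forall y \near x, 0 < bary j y.
  exact: (cvgr_gt _ (@bary_continuous j x) _ (hx j)).
exact: (@filter_forall _ _ (fun j y => 0 < bary j y) (nbhs x) _ nb).
Unshelve. all: by end_near. Qed.

(** Solves the equations [2 * dot (v i - v ord0) (c - v ord0) = sqn (v i - v ord0)] of the
    perpendicular bisector planes. *)
Definition circumcenter : 'rV[R]_3 :=
  v ord0 + (invmx (\matrix_(i < 3) (v (lift ord0 i) - v ord0)) *m
    \col_i (sqn (v (lift ord0 i) - v ord0) / 2))^T.

Lemma sqn_vertex_circumcenter j :
  sqn (v j - circumcenter) = sqn (v ord0 - circumcenter).
Proof.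
case: (unliftP ord0 j) => [i ->|-> //].
have e : dot (v (lift ord0 i) - v ord0) (circumcenter - v ord0) =
         sqn (v (lift ord0 i) - v ord0) / 2.
  rewrite /circumcenter [X in dot _ X]addrC addKr -/M.
  have := congr1 (fun B : 'cV_3 => B i 0)
    (mulKVmx Munit (\col_i (sqn (v (lift ord0 i) - v ord0) / 2))).
  rewrite [in X in _ = X -> _]mxE => <-; rewrite mxE; apply: eq_bigr => k _.
  by rewrite [X in _ * X = _]mxE; congr (_ * _); rewrite [RHS]mxE.
have -> : v (lift ord0 i) - circumcenter =
  (v (lift ord0 i) - v ord0) - (circumcenter - v ord0) by rewrite opprB addrA subrK.
by rewrite sqnB e -(sqnN (v ord0 - _)) opprB; field.
Qed.

(** The difference of two such centres is orthogonal to all edges at [v ord0], which span the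
    space. *)
Lemma circumcenter_unique c d : (forall j, sqn (v j - c) = d) -> c = circumcenter.
Proof.
move=> hc; apply/eqP; rewrite -subr_eq0; apply/eqP; apply: dot_eq => z.
have orth j : dot (v j - v ord0) (c - circumcenter) = 0.
  have e x y : sqn (v j - x) - sqn (v ord0 - x) - (sqn (v j - y) - sqn (v ord0 - y))
    = - 2 * dot (v j - v ord0) (x - y).
    by rewrite !sqnB !dotBl !dotBr; ring.
  have := e c circumcenter; rewrite !hc sqn_vertex_circumcenter !subrr.
  by move/eqP; rewrite eq_sym mulf_eq0 oppr_eq0 pnatr_eq0 /= => /eqP.
rewrite [RHS]dotC dot0l; have := bary_sum (z + v ord0).
move=> /(congr1 (fun x => dot (x - v ord0) (c - circumcenter))).
rewrite addrK => <-.
have -> : \sum_j bary j (z + v ord0) *: v j - v ord0 =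
   \sum_j bary j (z + v ord0) *: (v j - v ord0).
  under [in RHS]eq_bigr do rewrite scalerBr.
  by rewrite sumrB -scaler_suml sum_bary scale1r.
by rewrite dot_suml big1// => j _; rewrite dotZl orth mulr0.
Qed.

Lemma circumradiusE : circumradius (range v) = enorm (v ord0 - circumcenter).
Proof.
rewrite /circumradius; case: xgetP => [r _ [c hc]|/(_ (enorm (v ord0 - circumcenter)))].
  have rn j : enorm (v j - c) = r by apply: hc; exists j.
  have r0 : 0 <= r by rewrite -(rn ord0) sqrtr_ge0.
  have /circumcenter_unique <- : forall j, sqn (v j - c) = r ^+ 2.
    by move=> j; apply/enorm_eq.
  by rewrite rn.
case; exists circumcenter => _ [j _ <-].
by rewrite /esphere /= !enormE sqn_vertex_circumcenter.
Qed.

Lemma sqn_vertex j : sqn (v j - circumcenter) = circumradius (range v) ^+ 2.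
Proof.
by rewrite sqn_vertex_circumcenter circumradiusE enormE sqr_sqrtr ?sqn_ge0.
Qed.

Lemma circumradius_gt0 : 0 < circumradius (range v).
Proof.
rewrite circumradiusE enormE sqrtr_gt0 lt_neqAle sqn_ge0 andbT eq_sym.
apply/eqP => e; have e2 := sqn_vertex_circumcenter ord_max; rewrite e in e2.
move/sqn_eq0/eqP: e; move/sqn_eq0/eqP: e2; rewrite !subr_eq0 => /eqP e2 /eqP e1.
by have /vertex_inj : v ord0 = v ord_max by rewrite e1 e2.
Qed.

End Barycentric.

(** * The quadric [qF = 0] *)

Section QuadraticRoot.
Variables (R : realType) (m : R).
Hypothesis m0 : 0 < m.
Implicit Types b q : R.

(* The positive root of [q t^2 + b t - m], written so that [q = 0] is allowed. *)
Definition qroot b q : R := 2 * m / (b + Num.sqrt (b ^+ 2 + 4 * q * m)).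

Lemma qroot_den_gt0 b q : 0 <= q -> 0 < q \/ 0 < b ->
  0 < b + Num.sqrt (b ^+ 2 + 4 * q * m).
Proof.
move=> q0 [qp|bp]; last by rewrite ltr_wpDr ?sqrtr_ge0.
have qm : 0 < q * m by rewrite mulr_gt0.
rewrite -ltrBlDl sub0r (le_lt_trans (ler_norm _))// normrN -sqrtr_sqr ltr_sqrt.
  by rewrite ltrDl -mulrA mulr_gt0.
by rewrite ltr_wpDl ?sqr_ge0// -mulrA mulr_gt0.
Qed.

Lemma qroot_gt0 b q : 0 <= q -> 0 < q \/ 0 < b -> 0 < qroot b q.
Proof. by move=> q0 h; rewrite divr_gt0 ?mulr_gt0 ?qroot_den_gt0. Qed.

Lemma qrootP b q : 0 <= q -> 0 < q \/ 0 < b ->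
  - m + qroot b q * b + qroot b q ^+ 2 * q = 0.
Proof.
move=> q0 /(qroot_den_gt0 q0); rewrite /qroot.
have : 0 <= b ^+ 2 + 4 * q * m by rewrite addr_ge0 ?sqr_ge0// !mulr_ge0 // ltW.
move=> /sqr_sqrtr; set s := Num.sqrt _ => s2 D0.
have Dn : b + s != 0 by rewrite gt_eqF.
apply: (mulfI (_ : (b + s) ^+ 2 != 0)); first by rewrite expf_neq0.
rewrite mulr0; have -> : (b + s) ^+ 2 * (- m + 2 * m / (b + s) * b + (2 * m / (b + s)) ^+ 2 * q)
  = m * (b ^+ 2 + 4 * q * m - s ^+ 2) by field.
by rewrite s2 subrr mulr0.
Qed.

Lemma qroot1 b q : 0 <= q -> - m + b + q = 0 -> qroot b q = 1.
Proof.
move=> q0 e; have -> : b = m - q by rewrite -[LHS]subr0 -e; ring.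
rewrite /qroot; have -> : (m - q) ^+ 2 + 4 * q * m = (m + q) ^+ 2 by ring.
rewrite sqrtr_sqr ger0_norm; last by rewrite addr_ge0// ltW.
have -> : m - q + (m + q) = 2 * m by ring.
by rewrite divff// mulf_neq0 ?pnatr_eq0 ?gt_eqF.
Qed.

Lemma qroot_cvg (b q : R -> R) (s : R) : 0 <= q s -> 0 < q s \/ 0 < b s ->
  {for s, continuous b} -> {for s, continuous q} ->
  {for s, continuous (fun s => qroot (b s) (q s))}.
Proof.
move=> q0 h cb cq.
have c1 : b s ^+ 2 + 4 * q s * m @[s --> s] --> b s ^+ 2 + 4 * q s * m.
  exact: (cvgD (cvgM cb cb) (cvgM (cvgM (cvg_cst (4 : R)) cq) (cvg_cst m))).
have c2 : Num.sqrt (b s ^+ 2 + 4 * q s * m) @[s --> s] -->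
    Num.sqrt (b s ^+ 2 + 4 * q s * m).
  exact: (cvg_comp _ _ c1 (@sqrt_continuous R _)).
have := qroot_den_gt0 q0 h; rewrite lt0r => /andP[d0 _].
exact: (cvgM (cvg_cst (2 * m)) (cvgV d0 (cvgD cb c2))).
Qed.

End QuadraticRoot.

(* For points [u i] of the sphere of radius [r] centred at the origin, and
   [x = \sum_i l i *: u i] with [\sum_i l i = 1], one has [qB l l = r^2 - |x|^2],
   so [y i = l i / (r^2 - |x|^2)] solves [qF y = 0]. *)
Section Quadric.
Variables (R : realType) (n : nat) (I : finType) (u : I -> 'rV[R]_n) (r : R).
Hypothesis ur : forall i, sqn (u i) = r ^+ 2.
Implicit Types y z A : I -> R.

Definition qU y : 'rV[R]_n := \sum_i y i *: u i.
Definition qB y z : R :=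
  r ^+ 2 * (\sum_i y i) * (\sum_i z i) - dot (qU y) (qU z).
Definition qF y : R := qB y y - \sum_i y i.

Lemma eq_qF y z : y =1 z -> qF y = qF z.
Proof. by move=> /funext ->. Qed.

Lemma qBC y z : qB y z = qB z y.
Proof. by rewrite /qB dotC; ring. Qed.

Lemma sum_lin (a b : R) y z :
  \sum_i (a * y i + b * z i) = a * \sum_i y i + b * \sum_i z i.
Proof. by rewrite big_split /= !mulr_sumr. Qed.

Lemma qU_lin (a b : R) y z :
  qU (fun i => a * y i + b * z i) = a *: qU y + b *: qU z.
Proof.
rewrite /qU !scaler_sumr -big_split; apply: eq_bigr => i _ /=.
by rewrite scalerDl !scalerA.
Qed.

Lemma qB_linr (a b : R) w y z :
  qB w (fun i => a * y i + b * z i) = a * qB w y + b * qB w z.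
Proof. by rewrite /qB qU_lin sum_lin dotDr !dotZr; ring. Qed.

Lemma qB_lin2 (a b : R) y z :
  qB (fun i => a * y i + b * z i) (fun i => a * y i + b * z i) =
  a ^+ 2 * qB y y + 2 * a * b * qB y z + b ^+ 2 * qB z z.
Proof. by rewrite qB_linr (qBC _ y) (qBC _ z) !qB_linr (qBC z y); ring. Qed.

Lemma qF_line A z (t : R) :
  qF (fun i => A i + t * z i) =
  qF A + t * (2 * qB A z - \sum_i z i) + t ^+ 2 * qB z z.
Proof.
rewrite (@eq_qF _ (fun i => 1 * A i + t * z i)); last by move=> i; rewrite mul1r.
by rewrite /qF qB_lin2 sum_lin; ring.
Qed.

(** As the [u i] lie on one sphere, polarisation turns the coefficients of [qB] into half squared
    distances. These are nonnegative, whence the convexity of [qF] in nonnegative directions. *)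
Lemma qBE y z : qB y z = \sum_i \sum_j y i * z j * (sqn (u i - u j) / 2).
Proof.
rewrite /qB -mulrA [_ * \sum_i z i]mulr_suml mulr_sumr dot_suml -sumrB.
apply: eq_bigr => i _; rewrite dot_sumr mulr_sumr mulr_sumr -sumrB.
by apply: eq_bigr => j _; rewrite sqnB !ur dotZl dotZr; field.
Qed.

Lemma qB_ge0 y z : (forall i, 0 <= y i) -> (forall i, 0 <= z i) -> 0 <= qB y z.
Proof.
move=> y0 z0; rewrite qBE; do 2!apply: sumr_ge0 => ? _.
by rewrite !mulr_ge0 ?sqn_ge0.
Qed.

Lemma qB1_gt0 i j : u i != u j -> 0 < qB (fun=> 1) (fun=> 1).
Proof.
move=> uij; rewrite qBE (bigD1 i)//= (bigD1 j)//= !mul1r -addrA ltr_wpDr//; last first.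
  by rewrite divr_gt0 ?sqn_gt0 ?subr_eq0.
rewrite addr_ge0//; repeat (apply: sumr_ge0 => ? _).
  by rewrite !mul1r divr_ge0 ?sqn_ge0.
by rewrite !mul1r divr_ge0 ?sqn_ge0.
Qed.

(** Multiplied by the sum [S] of [y], this derivative equals [\sum_k z k * sqn (S *: u k - qU y)].
    On the quadric [S^-1 *: qU y] has squared norm [r ^+ 2 - S^-1], so it is strictly inside the
    sphere and differs from each [u k]. *)
Lemma qF_grad_gt0 y z i : (forall i, 0 < y i) -> qF y = 0 ->
  (forall i, 0 <= z i) -> 0 < z i -> 0 < 2 * qB y z - \sum_i z i.
Proof.
move=> y0 Fy z0 zi; set S := \sum_i y i; set Z := \sum_i z i.
have S0 : 0 < S.
  by rewrite /S (bigD1 i)//= ltr_pwDl// sumr_ge0// => k _; rewrite ltW.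
have UE : sqn (qU y) = r ^+ 2 * S ^+ 2 - S.
  by move: Fy; rewrite /qF /qB -/S -/(sqn _) => e; rewrite -[LHS]addr0 -e; ring.
have : 0 < \sum_k z k * sqn (S *: u k - qU y).
  rewrite (bigD1 i)//= ltr_pwDl//; last first.
    by apply: sumr_ge0 => k _; rewrite mulr_ge0 ?sqn_ge0.
  rewrite mulr_gt0// sqn_gt0// subr_eq0; apply/eqP => e.
  move: UE; rewrite -e sqnZ ur => /eqP; rewrite eq_sym subr_eq mulrC.
  by rewrite -subr_eq0 opprD addrA subrr sub0r oppr_eq0 gt_eqF.
rewrite sum_sqn_sub UE -/Z.
have -> : \sum_i z i *: (S *: u i) = S *: qU z.
  by rewrite scaler_sumr; apply: eq_bigr => k _; rewrite !scalerA mulrC.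
under eq_bigr do rewrite sqnZ ur.
rewrite -mulr_suml -/Z dotZl => h.
rewrite -(pmulr_rgt0 _ S0); apply: lt_le_trans h _; rewrite le_eqVlt; apply/orP; left.
by rewrite /qB -/S -/Z dotC; apply/eqP; ring.
Qed.

(* Along the segment from [A] to [y] the function [qF] is a convex quadratic,
   increasing at each of its zeros: the last zero is thus the only one. *)
Lemma qF_lt0 A y i : (forall i, 0 < A i) -> (forall i, A i <= y i) ->
  A i < y i -> qF y = 0 -> qF A < 0.
Proof.
move=> A0 Ay Ayi Fy; rewrite ltNge; apply/negP => FA.
pose z i := y i - A i.
have z0 k : 0 <= z k by rewrite subr_ge0.
have zi : 0 < z i by rewrite subr_gt0.
have y0 k : 0 < y k by apply: lt_le_trans (Ay k).
set b := 2 * qB A z - \sum_i z i; set q := qB z z.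
have e1 : qF A + b + q = 0.
  have := qF_line A z 1; rewrite expr1n !mul1r -/b -/q => <-.
  by rewrite -[RHS]Fy; apply: eq_qF => k; rewrite /z mul1r subrKC.
have grad t : 0 <= t -> qF A + t * b + t ^+ 2 * q = 0 -> 0 < b + 2 * t * q.
  move=> t0 e; pose w i := A i + t * z i.
  have := @qF_grad_gt0 w z i _ _ z0 zi.
  have -> : 2 * qB w z - \sum_i z i = b + 2 * t * q.
    have -> : w = (fun i => 1 * A i + t * z i) by apply/funext => k; rewrite mul1r.
    by rewrite qBC qB_linr (qBC z A) /b /q; ring.
  by apply=> [k|]; [rewrite ltr_wpDr ?mulr_ge0|rewrite qF_line].
have g1 : 0 < b + 2 * q by have := grad 1; rewrite expr1n !mul1r mulr1; apply.
have qA : qF A < q by lra.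
have q0 : 0 < q by apply: le_lt_trans qA.
(* Since 1 is a root, the product of the roots makes [qF A / q] the other one. The slope there is
   [qF A - q < 0], against [grad]. *)
have := grad (qF A / q); rewrite divr_ge0 ?(ltW q0)// => /(_ isT).
have -> : b = - (qF A + q) by lra.
have -> : qF A + qF A / q * - (qF A + q) + (qF A / q) ^+ 2 * q = 0.
  by field; rewrite gt_eqF.
move=> /(_ erefl); have -> : - (qF A + q) + 2 * (qF A / q) * q = qF A - q.
  by field; rewrite gt_eqF.
by rewrite subr_gt0 ltNge (ltW qA).
Qed.

(** The ray from [A] with all direction coordinates 1 meets the quadric; two distinct [u] make its
    leading coefficient positive. *)
Lemma qF_strict A i j : u i != u j -> qF A < 0 ->
  exists y, (forall i, A i < y i) /\ qF y = 0.
Proof.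
move=> uij FA; have m0 : 0 < - qF A by rewrite oppr_gt0.
have q0 := qB1_gt0 uij.
set q := qB _ _ in q0; set b := 2 * qB A (fun=> 1) - \sum_(i : I) 1.
have t0 := @qroot_gt0 _ _ m0 b q (ltW q0) (or_introl q0).
exists (fun i => A i + qroot (- qF A) b q * 1); split => [k|].
  by rewrite mulr1 ltrDl.
rewrite qF_line -/b -/q -[X in X + _ + _ = 0]opprK.
by apply: qrootP => //; [exact: ltW|left].
Qed.

(** The directions from [A] to the two ends are joined by a segment, and each is rescaled by [qroot]
    to land on the quadric. A direction coordinate vanishing at both ends vanishes throughout, so
    faces are preserved. *)
Lemma qF_path A y0 y1 : (forall i, A i <= y0 i) -> (forall i, A i <= y1 i) ->
  qF A < 0 -> qF y0 = 0 -> qF y1 = 0 ->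
  exists y : R -> I -> R, [/\ y 0 = y0, y 1 = y1 &
    forall s, 0 <= s <= 1 ->
      [/\ qF (y s) = 0, forall i, A i <= y s i,
          forall i, {for s, continuous (fun s => y s i)} &
          forall i, y0 i = A i -> y1 i = A i -> y s i = A i]].
Proof.
move=> Ay0 Ay1 FA F0 F1; have m0 : 0 < - qF A by rewrite oppr_gt0.
set m := - qF A in m0.
pose z0 i := y0 i - A i; pose z1 i := y1 i - A i.
have z0p k : 0 <= z0 k by rewrite subr_ge0.
have z1p k : 0 <= z1 k by rewrite subr_ge0.
pose z (s : R) i := (1 - s) * z0 i + s * z1 i.
pose q0 := qB z0 z0; pose q1 := qB z1 z1; pose q01 := qB z0 z1.
pose bb w := 2 * qB A w - \sum_i w i.
have E w y : (forall i, w i = y i - A i) -> qF y = 0 -> - m + bb w + qB w w = 0.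
  move=> wy Fy; have := qF_line A w 1; rewrite expr1n !mul1r opprK -/(bb w) => <-.
  by rewrite -[RHS]Fy; apply: eq_qF => k; rewrite wy mul1r subrKC.
have E0 := E z0 y0 (fun=> erefl) F0; have E1 := E z1 y1 (fun=> erefl) F1.
pose b (s : R) : R := (1 - s) * bb z0 + s * bb z1.
pose q (s : R) : R := (1 - s) ^+ 2 * q0 + 2 * (1 - s) * s * q01 + s ^+ 2 * q1.
have bE s : bb (z s) = b s by rewrite /bb /z qB_linr sum_lin /b /bb; ring.
have qE s : qB (z s) (z s) = q s by rewrite /z qB_lin2.
have q0p : 0 <= q0 by apply: qB_ge0.
have q1p : 0 <= q1 by apply: qB_ge0.
have q01p : 0 <= q01 by apply: qB_ge0.
have qp s : 0 <= s <= 1 -> 0 <= q s.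
  move=> /andP[s0 s1]; rewrite -qE qB_ge0// => k;
  by rewrite addr_ge0 ?mulr_ge0 ?subr_ge0.
have nd s : 0 <= s <= 1 -> 0 < q s \/ 0 < b s.
  move=> /andP[s0 s1].
  have [->|sn0] := eqVneq s 0.
    have : - m + bb z0 + q0 = 0 := E0.
    have [|qs] := ltP 0 q0; rewrite /q /b => *; [left|right]; lra.
  have [->|sn1] := eqVneq s 1.
    have : - m + bb z1 + q1 = 0 := E1.
    have [|qs] := ltP 0 q1; rewrite /q /b => *; [left|right]; lra.
  have sp : 0 < s by rewrite lt_neqAle eq_sym sn0.
  have s1p : 0 < 1 - s by rewrite subr_gt0 lt_neqAle sn1.
  have h01 : 0 <= 2 * (1 - s) * s * q01 by rewrite !mulr_ge0 // ltW.
  have h0 : 0 <= (1 - s) ^+ 2 * q0 by rewrite mulr_ge0 // sqr_ge0.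
  have h1 : 0 <= s ^+ 2 * q1 by rewrite mulr_ge0 // sqr_ge0.
  (* If [q0] and [q1] both vanish, [E0] and [E1] give [bb z0 = bb z1 = m], so [b s] is positive. *)
  have [q0_gt|q0_le] := ltP 0 q0.
    left; have : 0 < (1 - s) ^+ 2 * q0 by rewrite mulr_gt0 ?exprn_gt0.
    by rewrite /q; lra.
  have [q1_gt|q1_le] := ltP 0 q1.
    left; have : 0 < s ^+ 2 * q1 by rewrite mulr_gt0 ?exprn_gt0.
    by rewrite /q; lra.
  right; rewrite /b addr_gt0// mulr_gt0//.
    by have : - m + bb z0 + q0 = 0 := E0; lra.
  by have : - m + bb z1 + q1 = 0 := E1; lra.
have bc (s : R) : {for s, continuous b}.
  have cs : s @[s --> s] --> s := @cvg_id _ _.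
  exact: (cvgD (cvgM (cvgB (cvg_cst (1 : R)) cs) (cvg_cst _)) (cvgM cs (cvg_cst _))).
have qc (s : R) : {for s, continuous q}.
  have cs : s @[s --> s] --> s := @cvg_id _ _.
  have cs' : 1 - s @[s --> s] --> 1 - s by exact: (cvgB (cvg_cst (1 : R)) cs).
  have cs2 : s ^+ 2 @[s --> s] --> s ^+ 2 by exact: (cvgM cs cs).
  have cs'2 : (1 - s) ^+ 2 @[s --> s] --> (1 - s) ^+ 2 by exact: (cvgM cs' cs').
  exact: (cvgD (cvgD (cvgM cs'2 (cvg_cst q0))
    (cvgM (cvgM (cvgM (cvg_cst (2 : R)) cs') cs) (cvg_cst q01))) (cvgM cs2 (cvg_cst q1))).
exists (fun s i => A i + qroot m (b s) (q s) * z s i); split.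
- apply/funext => k; rewrite /z mul0r addr0 subr0 mul1r qroot1 ?mul1r ?subrKC//.
    by apply: qp; rewrite lexx ler01.
  by rewrite -[RHS]E0 /b /q -/q0; ring.
- apply/funext => k; rewrite /z subrr mul0r add0r mul1r qroot1 ?mul1r ?subrKC//.
    by apply: qp; rewrite lexx ler01.
  by rewrite -[RHS]E1 /b /q -/q1; ring.
move=> s s01; have t0 := qroot_gt0 m0 (qp s s01) (nd s s01).
have zs k : 0 <= z s k.
  by case/andP: s01 => s0 s1; rewrite addr_ge0 ?mulr_ge0 ?subr_ge0.
split => [|k|k|k e0 e1].
- rewrite qF_line -/(bb _) bE qE -[qF A]opprK -/m.
  by apply: qrootP; [|exact: qp|exact: nd].
- by rewrite lerDl mulr_ge0// ltW.
- have cs : s @[s --> s] --> s := @cvg_id _ _.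
  have ct := qroot_cvg m0 (qp s s01) (nd s s01) (bc s) (qc s).
  have cz : z s k @[s --> s] --> z s k.
    exact: (cvgD (cvgM (cvgB (cvg_cst (1 : R)) cs) (cvg_cst _)) (cvgM cs (cvg_cst _))).
  exact: (cvgD (cvg_cst (A k)) (cvgM ct cz)).
- by rewrite /z /z0 /z1 e0 e1 subrr !mulr0 addr0 mulr0 addr0.
Qed.

End Quadric.

(** * Opposite balls and the shape of the hulloid *)

Section Tetrahedron.
Variables (R : realType) (v : 'I_4 -> 'rV[R]_3).
Hypothesis hv : nondegenerate_tetrahedron v.

Notation r := (circumradius (range v)).
Notation c0 := (circumcenter v).
Notation g := (bgrad v).
Notation lam := (bary v).

Let r0 : 0 < r. Proof. exact: circumradius_gt0. Qed.

(* Minus the power of [x] with respect to the circumscribed sphere. *)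
Definition cpow (x : 'rV[R]_3) : R := r ^+ 2 - sqn (x - c0).

Lemma cpow_vertex j : cpow (v j) = 0.
Proof. by rewrite /cpow sqn_vertex// subrr. Qed.

Lemma cpow_continuous : continuous cpow.
Proof. move=> x; exact: (cvgB (cvg_cst (r ^+ 2)) (@sqn_sub_continuous _ _ c0 x)). Qed.

Lemma bary_sub_circumcenter x : \sum_j lam j x *: (v j - c0) = x - c0.
Proof.
under eq_bigr do rewrite scalerBr.
by rewrite sumrB -scaler_suml sum_bary scale1r bary_sum.
Qed.

(** Leibniz's formula, with all vertices at distance [r] from [c0]; it makes the sign of [cpow] on
    the tetrahedron visible. *)
Lemma cpow_bary x : cpow x = \sum_j lam j x * sqn (v j - x).
Proof.
rewrite (eq_bigr (fun j => lam j x * sqn ((v j - c0) - (x - c0)))).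
  rewrite sum_sqn_sub bary_sub_circumcenter sum_bary mul1r -/(sqn _).
  under eq_bigr do rewrite sqn_vertex//.
  by rewrite -mulr_suml sum_bary mul1r /cpow /sqn; ring.
by move=> j _; rewrite opprB addrA subrK.
Qed.

Lemma cpow_gt0 x : (forall j, 0 <= lam j x) -> ~ range v x -> 0 < cpow x.
Proof.
move=> lx xV; have t0 j : 0 <= lam j x * sqn (v j - x) by rewrite mulr_ge0 ?sqn_ge0.
rewrite cpow_bary lt_neqAle sumr_ge0// andbT eq_sym; apply/eqP => e.
have z j : lam j x = 0.
  have := psumr_eq0P (fun j _ => t0 j) e; move=> /(_ j isT)/eqP.
  rewrite mulf_eq0 => /orP[/eqP //|/eqP/sqn_eq0/eqP]; rewrite subr_eq0 => /eqP vx.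
  by case: xV; exists j.
by have := sum_bary v x; rewrite big1// => /eqP; rewrite eq_sym oner_eq0.
Qed.

Lemma dot_bgrad_vertex j k : dot (g j) (v k - c0) = (j == k)%:R - lam j c0.
Proof. by rewrite -baryB bary_vertex. Qed.

Lemma vec_bgrad z : z = \sum_k dot (g k) z *: (v k - c0).
Proof.
have := bary_sub_circumcenter (c0 + z); rewrite [c0 + z - c0]addrC addKr => {1}<-.
apply/eqP; rewrite -subr_eq0 -sumrB; apply/eqP.
under eq_bigr do rewrite -scalerBl.
rewrite -[RHS](subrr c0) -[RHS]bary_sub_circumcenter; apply: eq_bigr => k _.
by congr (_ *: _); have := baryB v k (c0 + z) c0; rewrite [c0 + z - c0]addrC addKr => <-; ring.
Qed.

(** Transpose of [vec_bgrad]. It expands centres in the gradients; as these sum to zero, all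
    coefficients may be shifted by one constant. *)
Lemma bgrad_dual w : w = \sum_k dot (v k - c0) w *: g k.
Proof.
apply: dot_eq => z; rewrite {1}(vec_bgrad z) dot_suml dot_sumr.
by apply: eq_bigr => k _; rewrite dotZl dotZr (dotC z) mulrC.
Qed.

(** * Powers, centres and spheres of the opposite balls *)

Let G j := sqn (g j).
Let G0 j : 0 < G j. Proof. by rewrite sqn_gt0// bgrad_neq0. Qed.

(* Power of [v j] with respect to the sphere [opp_sphere v rho j]. *)
Definition opp_pow (rho : R) (j : 'I_4) : R :=
  2 * (lam j c0 + Num.sqrt (lam j c0 ^+ 2 + sqn (g j) * (rho ^+ 2 - r ^+ 2))) /
  sqn (g j).
Notation K := opp_pow.

Let s2_gt0 rho : r < rho -> 0 < rho ^+ 2 - r ^+ 2.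
Proof. by move=> h; rewrite subr_gt0 ltr_pXn2r// ?nnegrE ?ltW// (lt_trans r0). Qed.

(** This quadratic, of which [K rho j] is the larger root, says that [c0 - (K rho j / 2) *: g j] is
    at distance [rho] from the vertices other than [v j]. *)
Lemma opp_pow_eq rho j : r < rho ->
  G j / 4 * K rho j ^+ 2 - lam j c0 * K rho j = rho ^+ 2 - r ^+ 2.
Proof.
move=> /s2_gt0 s0; rewrite /K -/(G j).
have : 0 <= lam j c0 ^+ 2 + G j * (rho ^+ 2 - r ^+ 2).
  by rewrite addr_ge0 ?sqr_ge0// mulr_ge0// ltW.
move=> /sqr_sqrtr; set s := Num.sqrt _ => e.
apply: (mulfI (_ : G j != 0)); first by rewrite gt_eqF.
have -> : G j * (G j / 4 * (2 * (lam j c0 + s) / G j) ^+ 2 -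
   lam j c0 * (2 * (lam j c0 + s) / G j)) = s ^+ 2 - lam j c0 ^+ 2.
  by field; rewrite gt_eqF.
by rewrite e; ring.
Qed.

Lemma opp_pow_gt0 rho j : r < rho -> 0 < K rho j.
Proof.
move=> /s2_gt0 s0; rewrite /opp_pow -/(G j) divr_gt0// mulr_gt0// -ltrBlDl sub0r.
rewrite (le_lt_trans (ler_norm _))// normrN -sqrtr_sqr ltr_sqrt.
  by rewrite ltrDl mulr_gt0.
by rewrite ltr_wpDl ?sqr_ge0// mulr_gt0.
Qed.

Let opp_pow_slope rho j : r < rho -> 0 < G j / 4 * K rho j - lam j c0.
Proof.
move=> h; have K0 := opp_pow_gt0 j h; rewrite -(pmulr_rgt0 _ K0).
by have := opp_pow_eq j h; have := s2_gt0 h; nra.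
Qed.

(** By contraposition: the quadratic of [opp_pow_eq] does not decrease beyond its larger root. Both
    monotonicity and unboundedness of [K] follow from this. *)
Lemma lt_opp_pow rho j (Y : R) : r < rho -> 0 <= Y ->
  G j / 4 * Y ^+ 2 - lam j c0 * Y < rho ^+ 2 - r ^+ 2 -> Y < K rho j.
Proof.
move=> h Y0; apply: contraTT; rewrite -!leNgt => KY.
rewrite -(opp_pow_eq j h) -subr_ge0.
have sl := opp_pow_slope j h; have G4 : 0 <= G j / 4 * Y by rewrite !mulr_ge0 // ltW.
have -> : G j / 4 * Y ^+ 2 - lam j c0 * Y - (G j / 4 * K rho j ^+ 2 - lam j c0 * K rho j)
  = (Y - K rho j) * (G j / 4 * Y + (G j / 4 * K rho j - lam j c0)) by ring.
by rewrite mulr_ge0 ?subr_ge0// addr_ge0// ltW.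
Qed.

Lemma opp_pow_lt rho rho' j : r < rho -> rho < rho' -> K rho j < K rho' j.
Proof.
move=> h h'; have h2 := lt_trans h h'; have K0 := opp_pow_gt0 j h.
apply: lt_opp_pow (ltW K0) _; rewrite // opp_pow_eq// ltrD2r.
by rewrite ltr_pXn2r// nnegrE ltW// (lt_trans r0).
Qed.

Lemma opp_pow_unbounded (Y : R) :
  exists2 rho, r < rho & forall j, Y < K rho j.
Proof.
pose Y' := `|Y| + 1; have Y0 : 0 <= Y' by rewrite addr_ge0.
pose B := \sum_j `|G j / 4 * Y' ^+ 2 - lam j c0 * Y'|.
have B0 : 0 <= B by rewrite sumr_ge0.
(* [B] bounds the quadratic at [Y'] for all four [j], and this radius makes [rho ^+ 2 - r ^+ 2]
   exceed [B]. *)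
exists (r + 1 + B); first by lra.
move=> j; apply: (@lt_trans _ _ Y'); first by rewrite (le_lt_trans (ler_norm Y))// ltrDl.
apply: lt_opp_pow => //; first by lra.
have : G j / 4 * Y' ^+ 2 - lam j c0 * Y' <= B.
  apply: le_trans (ler_norm _) _; rewrite /B (bigD1 j)//= lerDl.
  by rewrite sumr_ge0.
by have := r0; nra.
Qed.

Lemma opp_pow_continuous j : continuous (K ^~ j).
Proof.
move=> s; have cs : s @[s --> s] --> s := @cvg_id _ _.
have cs2 : s ^+ 2 @[s --> s] --> s ^+ 2 by exact: (cvgM cs cs).
have ci : lam j c0 ^+ 2 + sqn (g j) * (s ^+ 2 - r ^+ 2) @[s --> s] -->
  lam j c0 ^+ 2 + sqn (g j) * (s ^+ 2 - r ^+ 2).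
  exact: (cvgD (cvg_cst _) (cvgM (cvg_cst _) (cvgB cs2 (cvg_cst _)))).
have cq := cvg_comp _ _ ci (@sqrt_continuous R _).
exact: (cvgM (cvgM (cvg_cst (2 : R)) (cvgD (cvg_cst _) cq)) (cvg_cst _)).
Qed.

Let ctr rho j := c0 - (K rho j / 2) *: g j.

(** This sphere and the circumscribed one share the vertices of the facet opposite [v j], so their
    powers differ by an affine function vanishing there, a multiple of [lam j]. *)
Let sqn_ctr rho j x : r < rho ->
  sqn (x - ctr rho j) - rho ^+ 2 = K rho j * lam j x - cpow x.
Proof.
move=> h; have -> : x - ctr rho j = (x - c0) + (K rho j / 2) *: g j.
  by rewrite /ctr opprB addrCA addrC.
rewrite sqnD sqnZ dotZr dotC -baryB -/(G j) /cpow.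
have -> : rho ^+ 2 = r ^+ 2 + (G j / 4 * K rho j ^+ 2 - lam j c0 * K rho j).
  by rewrite opp_pow_eq//; ring.
by field.
Qed.

(** For a qualifying [c] the products [dot (v k - c0) (c - c0)], [k != j], agree, so [c - c0] is a
    multiple [beta] of [g j]. The radius gives a quadratic in [beta], and [v j] lying outside the
    ball selects its nonpositive root. *)
Lemma opp_centerE rho j : r < rho -> opp_center v rho j = c0 - (K rho j / 2) *: g j.
Proof.
move=> h; have rho0 : 0 < rho by apply: lt_trans h.
rewrite -/(ctr rho j) /opp_center.
case: xgetP => [c _ [cs cb]|/(_ (ctr rho j)) []]; last first.
  split.
    move=> _ /= [[k _ <-] kj]; apply/enorm_eq; first exact: ltW.
    have jk : (j == k) = false by apply/eqP => jk; apply: kj; rewrite jk.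
    by apply/eqP; rewrite -subr_eq0 sqn_ctr// bary_vertex// jk cpow_vertex mulr0 subr0.
  move=> /eballP -/(_ rho0); rewrite -subr_lt0 sqn_ctr// bary_vertex// cpow_vertex eqxx.
  by rewrite mulr1 subr0 ltNge ltW// opp_pow_gt0.
have csk k : k != j -> sqn (v k - c) = rho ^+ 2.
  move=> kj; apply/enorm_eq; [exact: ltW|apply: cs; split; first by exists k].
  by move/(vertex_inj hv)/eqP; exact/negP.
have cbj : rho ^+ 2 <= sqn (v j - c).
  by rewrite leNgt; apply/negP => /(eballP _ _ rho0).
have pk k : sqn (v k - c) = r ^+ 2 - 2 * dot (v k - c0) (c - c0) + sqn (c - c0).
  have -> : v k - c = (v k - c0) - (c - c0) by rewrite opprB addrA subrK.
  by rewrite sqnB sqn_vertex.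
pose tau := (r ^+ 2 + sqn (c - c0) - rho ^+ 2) / 2.
have dk k : k != j -> dot (v k - c0) (c - c0) = tau.
  by move=> kj; rewrite /tau -(csk _ kj) pk; field.
pose beta := dot (v j - c0) (c - c0) - tau.
have cE : c - c0 = beta *: g j.
  have z0 : tau *: \sum_k g k = 0 by rewrite sum_bgrad scaler0.
  rewrite (bgrad_dual (c - c0)) -[RHS]addr0 -[X in _ = _ + X]z0 scaler_sumr.
  rewrite (bigD1 j)//= [in RHS](bigD1 j)//= addrA -scalerDl subrK; congr (_ + _).
  by apply: eq_bigr => k kj; rewrite dk.
have [k kj] : exists k, k != j.
  by exists (if j == ord0 then ord_max else ord0); case: ifP => [/eqP ->|/negbT]//; rewrite eq_sym.
have ek : G j * beta ^+ 2 + 2 * lam j c0 * beta = rho ^+ 2 - r ^+ 2.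
  have := csk _ kj; rewrite pk cE dotZr sqnZ dotC dot_bgrad_vertex eq_sym (negPf kj) sub0r -/(G j).
  by lra.
have b0 : beta <= 0.
  move: cbj; rewrite pk cE dotZr sqnZ dotC dot_bgrad_vertex eqxx -/(G j).
  by move: ek; rewrite mulr1n; lra.
suff bE : beta = - (K rho j / 2).
  by rewrite /ctr -scaleNr -bE -cE subrKC.
have eK := opp_pow_eq j h; have sl := opp_pow_slope j h.
have : (- 2 * beta - K rho j) * (G j / 4 * K rho j - lam j c0 + G j / 4 * (- 2 * beta)) = 0.
  by rewrite -[RHS](subrr (rho ^+ 2 - r ^+ 2)) -{1}ek -eK; field.
move/eqP; rewrite mulf_eq0 => /orP[/eqP|/eqP]; first by lra.
have : 0 <= G j / 4 * (- 2 * beta) by rewrite mulr_ge0 ?divr_ge0 ?(ltW (G0 j))//; lra.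
lra.
Qed.

Lemma opp_ballP rho j x : r < rho -> opp_ball v rho j x <-> K rho j * lam j x < cpow x.
Proof.
move=> h; rewrite /opp_ball opp_centerE// eballP; last exact: lt_trans h.
by rewrite -subr_lt0 sqn_ctr// subr_lt0.
Qed.

Lemma opp_sphereP rho j x : r < rho ->
  opp_sphere v rho j x <-> K rho j * lam j x = cpow x.
Proof.
move=> h; rewrite /opp_sphere opp_centerE// /esphere /= enorm_eq; last first.
  by rewrite ltW// (lt_trans r0).
split => /eqP; rewrite -subr_eq0.
  by rewrite sqn_ctr// subr_eq0 => /eqP.
by rewrite -(sqn_ctr _ _ h) subr_eq0 => /eqP.
Qed.

Lemma tetra_coreP rho x : r < rho -> tetra_core v rho x <->
  (forall j, 0 < lam j x) /\ (forall j, cpow x <= K rho j * lam j x).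
Proof.
move=> h; rewrite /tetra_core interior_convex_hull//; split => /= -[l0 hx]; split => //.
  move=> j; rewrite leNgt; apply/negP => /(opp_ballP _ _ h) xj.
  by apply: hx; exists j.
by move=> [j _ /(opp_ballP _ _ h)]; rewrite ltNge hx.
Qed.

(** * The hulloid as the union of the vertices and the core *)

Lemma hulloid_bary_ge0 rho x : 0 < rho -> hulloid rho (range v) x ->
  forall j, 0 <= lam j x.
Proof.
move=> rho0 /(hulloidP _ _ rho0) hx j; rewrite leNgt; apply/negP => xj.
(* With this [t] the ball of radius [rho] about [x - t *: g j] contains [x] but misses the
   half-space [0 <= lam j], hence all vertices. *)
pose t := qroot (rho ^+ 2) (- 2 * lam j x) (G j).
have m0 : 0 < rho ^+ 2 by rewrite exprn_gt0.
have Gj := G0 j.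
have t0 : 0 < t by apply: qroot_gt0 => //; [exact: ltW|left].
have te : - rho ^+ 2 + t * (- 2 * lam j x) + t ^+ 2 * G j = 0.
  by apply: qrootP => //; [exact: ltW|left].
have := hx (x - t *: g j); rewrite subKr sqnZ -/(G j).
have -> : (rho ^+ 2 <= t ^+ 2 * G j) = false.
  apply/negbTE; rewrite -ltNge.
  have : 0 < t * (- 2 * lam j x) by rewrite mulr_gt0//; lra.
  lra.
suff H : forall e, range v e -> rho ^+ 2 <= sqn (e - (x - t *: g j)) by move/(_ H).
move=> _ [k _ <-]; rewrite opprB addrCA addrC -/(sqn _) sqnD dotZr dotC -baryB sqnZ -/(G j).
rewrite bary_vertex//; have := sqn_ge0 (v k - x).
have : 0 <= t * (j == k)%:R by rewrite mulr_ge0 ?ler0n// ltW.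
lra.
Qed.

(** Monotonicity reduces to radius [r], where the open circumscribed ball misses the vertices but
    contains every other point of the tetrahedron. *)
Lemma hulloid_le_circumradius rho : 0 < rho -> rho <= r ->
  hulloid rho (range v) = range v.
Proof.
move=> rho0 rhor; apply/seteqP; split; last exact: sub_hulloid.
move=> x /(hulloid_le rho0 rhor) hx; apply: contrapT => xV.
have := cpow_gt0 (hulloid_bary_ge0 r0 hx) xV; rewrite /cpow subr_gt0 ltNge.
move/(hulloidP _ _ r0): hx => ->// _ [k _ <-].
by rewrite sqn_vertex.
Qed.

(** The opposite balls contain no vertex, so the hulloid avoids them; then [0 < cpow x] forces every
    [lam j x] to be positive. *)
Let hulloid_sub_core rho : r < rho ->
  hulloid rho (range v) `<=` range v `|` tetra_core v rho.
Proof.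
move=> h x hx; have rho0 : 0 < rho by apply: lt_trans h.
have [xV|xV] := pselect (range v x); [by left|right].
have lx := hulloid_bary_ge0 rho0 hx; have W0 := cpow_gt0 lx xV.
have hK j : cpow x <= K rho j * lam j x.
  rewrite -subr_ge0 -sqn_ctr// subr_ge0; move/(hulloidP _ _ rho0): hx; apply.
  move=> _ [k _ <-]; rewrite -subr_ge0 sqn_ctr// cpow_vertex subr0 bary_vertex//.
  by rewrite mulr_ge0 ?ler0n// ltW// opp_pow_gt0.
apply/tetra_coreP => //; split => // j.
by rewrite -(pmulr_rgt0 _ (opp_pow_gt0 j h)); exact: lt_le_trans (hK j).
Qed.

(* If [v i] is the vertex closest to [c], then [c - c0] is a nonnegative
   combination [\sum_j a j *: (c_j - c0)] over the centres [c_j], [j != i], of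
   the opposite balls.  Convexity of the ball of radius [rho] about [v i] forces
   [\sum_j a j >= 1], and [|v i - c|^2 - |x - c|^2] is affine in [c], equal to
   [cpow x] at [c0] and nonpositive at each [c_j]. *)
Let core_sub_hulloid rho : r < rho -> tetra_core v rho `<=` hulloid rho (range v).
Proof.
move=> h x /(tetra_coreP _ h)[lx hK]; have rho0 : 0 < rho by apply: lt_trans h.
apply/hulloidP => // c hc.
have {}hc k : rho ^+ 2 <= sqn (v k - c) by apply: hc; exists k.
set d := c - c0.
have subE y : y - c = (y - c0) - d by rewrite opprB addrA subrK.
have pE y : sqn (y - c) = sqn (y - c0) - 2 * dot (y - c0) d + sqn d.
  by rewrite subE sqnB.
have [i _ imin] := @arg_minP _ _ _ ord0 xpredT (fun k => sqn (v k - c)) isT.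
have {}imin j : dot (v j - c0) d <= dot (v i - c0) d.
  by have := imin j isT; rewrite !pE !sqn_vertex//; lra.
pose ga j := dot (v i - c0) d - dot (v j - c0) d.
have K0 j := opp_pow_gt0 j h.
pose a j := 2 * ga j / K rho j.
have a0 j : 0 <= a j by rewrite divr_ge0 ?(ltW (K0 j))// mulr_ge0 ?subr_ge0.
have ai : a i = 0 by rewrite /a /ga subrr mulr0 mul0r.
pose e j := - (K rho j / 2) *: g j.
have dE : d = \sum_j a j *: e j.
  have z0 : dot (v i - c0) d *: \sum_k g k = 0 by rewrite sum_bgrad scaler0.
  rewrite [LHS]bgrad_dual -[LHS]subr0 -[X in _ - X = _]z0 scaler_sumr -sumrB; apply: eq_bigr => j _.
  rewrite -scalerBl scalerA /a /ga; congr (_ *: _); field.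
  by rewrite gt_eqF.
set S := \sum_j a j.
have S1 : 1 <= S.
  rewrite leNgt; apply/negP => S1.
  (* For [j != i] the vertex [v i] is on the sphere about [c0 + e j]; for [j = i] the weight is
     zero. *)
  have ej j : a j * (sqn (e j) - 2 * dot (v i - c0) (e j)) = a j * (rho ^+ 2 - r ^+ 2).
    have [->|ji] := eqVneq j i; first by rewrite ai !mul0r.
    congr (_ * _); have := sqn_ctr j (v i) h.
    have -> : v i - ctr rho j = (v i - c0) - e j.
      by rewrite /ctr /e scaleNr opprK opprB addrCA addrC.
    by rewrite bary_vertex// cpow_vertex (negPf ji) mulr0 subr0 sqnB sqn_vertex//; lra.
  have sd : sqn d <= \sum_j a j * sqn (e j).
    rewrite {1}dE; apply: le_trans (sqn_jensen _ a0) _; rewrite -/S.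
    by rewrite ler_piMl// ?(ltW S1)// sumr_ge0// => j _; rewrite mulr_ge0 ?sqn_ge0.
  have dd : dot (v i - c0) d = \sum_j a j * dot (v i - c0) (e j).
    by rewrite {1}dE dot_sumr; apply: eq_bigr => j _; rewrite dotZr.
  have : sqn (v i - c) <= r ^+ 2 + S * (rho ^+ 2 - r ^+ 2).
    have -> : S * (rho ^+ 2 - r ^+ 2) =
        \sum_j a j * sqn (e j) - 2 * \sum_j a j * dot (v i - c0) (e j).
      rewrite mulr_suml mulr_sumr -sumrB; apply: eq_bigr => j _.
      by rewrite -ej; ring.
    by rewrite pE sqn_vertex// dd; move: sd; lra.
  by have := hc i; have := s2_gt0 h; nra.
apply: le_trans (hc i) _; rewrite -subr_ge0.
have -> : sqn (x - c) - sqn (v i - c) = 2 * dot (v i - x) d - cpow x.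
  rewrite !pE sqn_vertex// /cpow; have -> : v i - x = (v i - c0) - (x - c0).
    by rewrite opprB addrA subrK.
  by rewrite [dot (_ - _ - _) _]dotBl; ring.
have -> : 2 * dot (v i - x) d = \sum_j a j * (K rho j * lam j x).
  rewrite dE dot_sumr mulr_sumr; apply: eq_bigr => j _.
  rewrite dotZr /e dotZr dotC -baryB bary_vertex//.
  have [->|ji] := eqVneq j i; first by rewrite ai; ring.
  by rewrite sub0r; field.
rewrite subr_ge0; apply: (@le_trans _ _ (S * cpow x)).
  rewrite ler_peMl// ltW//; apply: cpow_gt0 => [j|]; first exact: ltW.
  move=> [k _ xk]; have := lx (if k == ord0 then ord_max else ord0).
  rewrite -xk bary_vertex//; case: ifP => [/eqP ->|/negbT]; first by rewrite ltxx.
  by rewrite eq_sym => /negPf ->; rewrite ltxx.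
by rewrite mulr_suml; apply: ler_sum => j _; rewrite ler_wpM2l.
Qed.

Lemma hulloidE rho : r < rho ->
  hulloid rho (range v) = range v `|` tetra_core v rho.
Proof.
move=> h; apply/seteqP; split; first exact: hulloid_sub_core.
move=> x [|]; last exact: core_sub_hulloid.
by apply: sub_hulloid; exact: lt_trans h.
Qed.

End Tetrahedron.

(** * The core in quadric coordinates *)

Lemma connected_by_paths (R : realType) (T : topologicalType) (X : set T) :
  (forall x y, X x -> X y -> exists f : R -> T, [/\ f 0 = x, f 1 = y &
     forall s, 0 <= s <= 1 -> X (f s) /\ {for s, continuous f}]) ->
  connected X.
Proof.
move=> hX; have [->|/set0P[x Xx]] := eqVneq X set0; first exact: connected0.
have -> : X = \bigcup_(C in [set C | [/\ connected C, C x & C `<=` X]]) C.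
  apply/seteqP; split => [y Xy|y [C [_ _ CX]] Cy]; last exact: CX.
  have [f [f0 f1 hf]] := hX x y Xx Xy.
  exists (f @` `[0, 1]); last first.
    by exists 1 => //=; rewrite in_itv /= ler01 lexx.
  split => /=.
  - apply: connected_continuous_connected; first exact: segment_connected.
    apply: continuous_in_subspaceT => s; rewrite inE /= in_itv /= => s01.
    by have [] := hf s s01.
  - by exists 0 => //=; rewrite in_itv /= ler01 lexx.
  - by move=> _ [s /= + <-]; rewrite in_itv /= => /hf[].
apply: bigcup_connected => [|C [] //].
by exists x => C [].
Qed.

Lemma finite_IVT (R : realType) (I : finType) (F : I -> R -> R) (L : R) (i0 : I) :
  0 <= L -> (forall i, continuous (F i)) -> (forall i, 0 <= F i 0) -> F i0 L < 0 ->
  exists2 s, 0 <= s <= L & (forall i, 0 <= F i s) /\ exists i, F i s = 0.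
Proof.
(* The intermediate value theorem is applied to the minimum of the [F i]. The initial value 1 is
   positive, so it is never what makes the minimum vanish. *)
move=> L0 cF F0 FL; pose f s := \big[Num.min/1]_i F i s.
have cf : continuous f.
  by move=> s; apply: (@cvg_big R) => [|i _]; [exact: min_continuous|exact: cF].
have f0 : 0 <= f 0 by apply: le_bigmin.
have fL : f L < 0 by apply: le_lt_trans (bigmin_le _ i0 _) FL.
have [||s] := @IVT R f 0 L 0 L0; first exact: continuous_subspaceT.
  by rewrite ge_min le_max f0 (ltW fL) orbT.
rewrite in_itv /= => sL fs; exists s => //; split => [i|].
  by rewrite -fs bigmin_le.
apply: contrapT => nF; suff : 0 < f s by rewrite fs ltxx.
apply: lt_bigmin => // i _; rewrite lt_neqAle -{2}fs bigmin_le andbT.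
by apply/eqP => e; apply: nF; exists i.
Qed.

Section Core.
Variables (R : realType) (v : 'I_4 -> 'rV[R]_3).
Hypothesis hv : nondegenerate_tetrahedron v.

Notation r := (circumradius (range v)).
Notation c0 := (circumcenter v).
Notation lam := (bary v).
Notation W := (cpow v).
Notation K := (opp_pow v).
Notation Q := (qF (fun j => v j - c0) r).

Let r0 : 0 < r. Proof. exact: circumradius_gt0. Qed.

Let ur j : sqn (v j - c0) = r ^+ 2. Proof. exact: sqn_vertex. Qed.

Let u01 : v ord0 - c0 != v ord_max - c0.
Proof. by apply/eqP => /addIr/(vertex_inj hv). Qed.

Definition bary_over_cpow x j : R := lam j x / W x.
Notation Y := bary_over_cpow.

(** Inverse of [bary_over_cpow]: the coordinates of [x] sum to [(W x)^-1], so dividing by their sum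
    recovers the barycentric ones. *)
Definition point_of_coords (y : 'I_4 -> R) : 'rV[R]_3 :=
  \sum_j (y j / \sum_k y k) *: v j.
Notation P := point_of_coords.

Lemma sum_coords x : \sum_j Y x j = (W x)^-1.
Proof. by rewrite -mulr_suml sum_bary mul1r. Qed.

Lemma qF_coords x : 0 < W x -> Q (Y x) = 0.
Proof.
move=> W0; rewrite /qF /qB sum_coords.
have -> : qU (fun j => v j - c0) (Y x) = (W x)^-1 *: (x - c0).
  rewrite -bary_sub_circumcenter// scaler_sumr; apply: eq_bigr => j _.
  by rewrite scalerA mulrC.
have -> : dot ((W x)^-1 *: (x - c0)) ((W x)^-1 *: (x - c0)) = (W x)^-1 ^+ 2 * (r ^+ 2 - W x).
  by rewrite -/(sqn _) sqnZ /cpow subKr.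
by field; rewrite gt_eqF.
Qed.

Section PointOfCoords.
Variable y : 'I_4 -> R.
Hypotheses (y0 : forall j, 0 < y j).

Lemma coords_sum_gt0 : 0 < \sum_j y j.
Proof. by rewrite (bigD1 ord0)//= ltr_pwDl// sumr_ge0// => j _; rewrite ltW. Qed.
Let S0 := coords_sum_gt0.

Lemma bary_point j : lam j (P y) = y j / \sum_k y k.
Proof. by rewrite bary_comb// -mulr_suml divff// gt_eqF. Qed.

Lemma cpow_point : Q y = 0 -> W (P y) = (\sum_j y j)^-1.
Proof.
move=> Fy; have xE : P y - c0 = (\sum_j y j)^-1 *: qU (fun j => v j - c0) y.
  rewrite -bary_sub_circumcenter// scaler_sumr; apply: eq_bigr => j _.
  by rewrite bary_point scalerA mulrC.
have e : sqn (qU (fun j => v j - c0) y) = r ^+ 2 * (\sum_j y j) ^+ 2 - \sum_j y j.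
  by move: Fy; rewrite /qF /qB -/(sqn _); lra.
by rewrite /cpow xE sqnZ e; field; rewrite gt_eqF.
Qed.

Lemma coords_point : Q y = 0 -> Y (P y) = y.
Proof.
by move=> Fy; apply/funext => j; rewrite /Y cpow_point// bary_point invrK mulfVK// gt_eqF.
Qed.

End PointOfCoords.

Lemma point_coords x : 0 < W x -> P (Y x) = x.
Proof.
move=> W0; rewrite -[RHS](bary_sum hv); apply: eq_bigr => j _.
by rewrite sum_coords invrK mulfVK// gt_eqF.
Qed.

Definition opp_coords rho j : R := (K rho j)^-1.
Notation A := opp_coords.

Lemma opp_coords_gt0 rho j : r < rho -> 0 < A rho j.
Proof. by move=> h; rewrite invr_gt0 opp_pow_gt0. Qed.

Lemma cpow_interior_gt0 x : (forall j, 0 < lam j x) -> 0 < W x.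
Proof.
move=> lx; apply: cpow_gt0 => [//|j|]; first exact: ltW.
move=> [k _ xk]; have := lx (if k == ord0 then ord_max else ord0).
rewrite -xk bary_vertex//; case: ifP => [/eqP ->|/negbT]; first by rewrite ltxx.
by rewrite eq_sym => /negPf ->; rewrite ltxx.
Qed.

Lemma core_coords rho x : r < rho -> tetra_core v rho x ->
  [/\ 0 < W x, forall j, A rho j <= Y x j & Q (Y x) = 0].
Proof.
move=> h /(tetra_coreP hv _ h)[lx hK]; have W0 := cpow_interior_gt0 lx.
split=> [//|j|]; last exact: qF_coords.
by rewrite ler_pdivlMr// ler_pdivrMl ?opp_pow_gt0.
Qed.

Lemma opp_sphere_coords rho x j : r < rho -> 0 < W x ->
  opp_sphere v rho j x <-> Y x j = A rho j.
Proof.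
move=> h W0; rewrite opp_sphereP//; have Kn : K rho j != 0 by rewrite gt_eqF ?opp_pow_gt0.
have Wn : W x != 0 by rewrite gt_eqF.
split=> [e|]; first by rewrite /Y /A -e invfM mulrCA divff ?mulr1//;
  apply: contraNneq Wn => l0; rewrite -e l0 mulr0.
by rewrite /Y /A => /(canRL (mulfVK Wn)) ->; rewrite mulrA divff// mul1r.
Qed.

Lemma core_point rho y : r < rho -> (forall j, A rho j <= y j) -> Q y = 0 ->
  tetra_core v rho (P y).
Proof.
move=> h Ay Fy; have y0 j : 0 < y j by apply: lt_le_trans (Ay j); exact: opp_coords_gt0.
have S0 := coords_sum_gt0 y0.
apply/tetra_coreP => //; split=> j; first by rewrite bary_point// divr_gt0.
rewrite cpow_point// bary_point// mulrA ler_pdivlMr// mulVf ?gt_eqF//.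
by rewrite -ler_pdivrMl ?opp_pow_gt0// mulr1; exact: Ay.
Qed.

(** If some coordinate of [x] exceeds that of [A rho], [qF_lt0] applies. At the full radius this
    leaves a single core point. *)
Lemma core_dichotomy rho x : r < rho -> tetra_core v rho x ->
  Y x = A rho \/ Q (A rho) < 0.
Proof.
move=> h xc; have [W0 AY FY] := core_coords h xc.
have [e|/existsNP[j /eqP ne]] := pselect (forall j, Y x j = A rho j).
  by left; apply/funext.
right; apply: (qF_lt0 ur (i := j) (y := Y x)) => // [k|].
  exact: opp_coords_gt0.
by rewrite lt_neqAle eq_sym ne AY.
Qed.

Lemma core_strict_exists rho : r < rho -> Q (A rho) < 0 ->
  exists2 x, forall j, 0 < lam j x & forall j, W x < K rho j * lam j x.
Proof.
move=> h FA; have [y [Ay Fy]] := qF_strict ur u01 FA.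
have y0 j : 0 < y j by apply: lt_trans (Ay j); exact: opp_coords_gt0.
have S0 := coords_sum_gt0 y0.
exists (P y) => j; first by rewrite bary_point// divr_gt0.
rewrite cpow_point// bary_point// mulrA ltr_pdivlMr// mulVf ?gt_eqF//.
by rewrite -ltr_pdivrMl ?opp_pow_gt0// mulr1; exact: Ay.
Qed.

Lemma core_interior rho x : r < rho -> (forall j, 0 < lam j x) ->
  (forall j, W x < K rho j * lam j x) -> interior (tetra_core v rho) x.
Proof.
move=> h lx hK; rewrite /interior /=.
have n1 j : \forall y \near x, 0 < lam j y.
  exact: (cvgr_gt _ (@bary_continuous _ v j x) _ (lx j)).
have n2 j : \forall y \near x, 0 < K rho j * lam j y - W y.
  have c : K rho j * lam j y - W y @[y --> x] --> K rho j * lam j x - W x.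
    exact: (cvgB (cvgM (cvg_cst (K rho j)) (@bary_continuous _ v j x))
             (@cpow_continuous _ v x)).
  by apply: (cvgr_gt _ c); rewrite subr_gt0.
have N1 := @filter_forall _ _ (fun j y => 0 < lam j y) (nbhs x) _ n1.
have N2 := @filter_forall _ _ (fun j y => 0 < K rho j * lam j y - W y) (nbhs x) _ n2.
suff : \forall y \near x, tetra_core v rho y by [].
near=> y; apply/tetra_coreP => //; split => j; first by move: j; near: y; exact: N1.
rewrite -subr_ge0 ltW//; move: j; near: y; exact: N2.
Unshelve. all: by end_near. Qed.

(** * Fullness, the full radius and the sign of the quadric at the corner *)

Notation Rstar := (full_radius (range v)).
Notation full rho := (hulloid_full rho (range v)).

Lemma full_of_strict rho x : r < rho -> (forall j, 0 < lam j x) ->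
  (forall j, W x < K rho j * lam j x) -> full rho.
Proof.
move=> h lx hK; exists x; rewrite hulloidE//.
by apply: (interiorS (A := tetra_core v rho)); [move=> z ?; right|exact: core_interior].
Qed.

Lemma core_of_full rho : r < rho -> full rho -> tetra_core v rho !=set0.
Proof.
move=> h; rewrite /hulloid_full hulloidE// => -[x xi]; apply: contrapT => ne.
have [k _ xk] : range v x.
  by have [|xc] := interior_subset xi => //; case: ne; exists x.
(* The interior point [x] is now a vertex. A short move towards [c0] stays in the hulloid and enters
   the open circumscribed ball, which contains no vertex. *)
have nl := @near_line _ _ x (c0 - x) _ xi.
near (0 : R)^'+ => t.
have [[k' _ e]|tc] : (range v `|` tetra_core v rho) (x + t *: (c0 - x)).
- by near: t; exact: nl.
- have := cpow_vertex hv k'; rewrite e /cpow.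
  have -> : x + t *: (c0 - x) - c0 = (1 - t) *: (x - c0).
    by rewrite addrAC scalerBl scale1r -[c0 - x]opprB scalerN.
  rewrite sqnZ -xk ur.
  have t0 : 0 < t by [].
  have t1 : t < 1 by near: t; exact: nbhs_right_lt.
  have r2 : 0 < r ^+ 2 by rewrite exprn_gt0.
  have -> : r ^+ 2 - (1 - t) ^+ 2 * r ^+ 2 = r ^+ 2 * (t * (2 - t)) by ring.
  by apply/eqP; rewrite gt_eqF// !mulr_gt0//; lra.
- by apply: ne; exists (x + t *: (c0 - x)).
Unshelve. all: by end_near. Qed.

Lemma full_exists : exists rho, r < rho /\ full rho.
Proof.
pose x := \sum_j (4^-1 : R) *: v j.
have lx j : lam j x = 4^-1.
  by rewrite bary_comb// !big_ord_recl big_ord0; field.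
have [rho h hK] := opp_pow_unbounded hv (4 * W x).
exists rho; split => //; apply: (@full_of_strict rho x) => // j; rewrite lx.
  by rewrite invr_gt0.
by have := hK j; lra.
Qed.

Lemma full_radius_le rho : r < rho -> full rho -> Rstar <= rho.
Proof. by move=> h f; apply: ge_inf => //; exists r => z [/ltW]. Qed.

Lemma circumradius_le_full_radius : r <= Rstar.
Proof.
apply: lb_le_inf => [|z [/ltW] //].
by have [rho] := full_exists; exists rho.
Qed.

(** As [K] increases strictly, a core point at [rho] satisfies strict inequalities at any larger
    radius, making the midpoint of [rho] and [Rstar] full. *)
Lemma core_empty rho : r < rho -> rho < Rstar -> tetra_core v rho = set0.
Proof.
move=> h hR; apply/seteqP; split => // x /(tetra_coreP hv _ h)[lx hK].
pose rho' := (rho + Rstar) / 2.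
have h' : rho < rho' by rewrite /rho'; lra.
suff : Rstar <= rho' by rewrite /rho'; lra.
apply: full_radius_le; first exact: lt_trans h'.
apply: (@full_of_strict _ x) => // [|j]; first exact: lt_trans h'.
by apply: le_lt_trans (hK j) _; rewrite ltr_pM2r// opp_pow_lt.
Qed.

(** Some full [rho'] lies below [rho]; a core point for [rho'] has coordinates at least [A rho'],
    hence strictly above [A rho]. *)
Lemma qF_opp_coords_lt0 rho : Rstar < rho -> Q (A rho) < 0.
Proof.
move=> hR; have h : r < rho by apply: le_lt_trans hR; exact: circumradius_le_full_radius.
have ne : [set rho | r < rho /\ full rho] !=set0 by have [z] := full_exists; exists z.
have [rho' [h' f'] hh'] := inf_lt ne hR.
have [x xc] := core_of_full h' f'.
have [W0 AY FY] := core_coords h' xc.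
have AA j : A rho j < A rho' j by rewrite ltf_pV2 ?posrE ?opp_pow_gt0// opp_pow_lt.
apply: (qF_lt0 ur (i := ord0) (y := Y x)) => // [k|k|].
- exact: opp_coords_gt0.
- by rewrite ltW// (lt_le_trans (AA k)).
- exact: lt_le_trans (AY _).
Qed.

Lemma qF_opp_coords_continuous rho : r < rho ->
  {for rho, continuous (fun s => Q (A s))}.
Proof.
move=> h.
have cA j : A s j @[s --> rho] --> A rho j.
  by apply: cvgV; [rewrite gt_eqF ?opp_pow_gt0|exact: opp_pow_continuous].
have cS : \sum_j A s j @[s --> rho] --> \sum_j A rho j.
  exact: (@cvg_sumr _ _ _ _ R^o _ (fun j s => A s j)).
have cU : qU (fun j => v j - c0) (A s) @[s --> rho] --> qU (fun j => v j - c0) (A rho).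
  apply: (@cvg_sumr _ _ _ _ _ _ (fun j s => A s j *: (v j - c0))) => j.
  exact: (cvgZ (cA j) (cvg_cst _)).
exact: (cvgB (cvgB (cvgM (cvgM (cvg_cst (r ^+ 2)) cS) cS) (dot_cvg cU cU)) cS).
Qed.

(** A positive value would persist just above [Rstar], against [qF_opp_coords_lt0]; a negative one
    would persist just below and make smaller radii full. *)
Lemma qF_opp_coords_full_radius : r < Rstar -> Q (A Rstar) = 0.
Proof.
move=> h; have c := qF_opp_coords_continuous h.
apply/eqP; rewrite eq_le !leNgt; apply/andP; split; apply/negP => F0.
  have n1 := cvgr_gt _ (cvg_at_right_filter c) _ F0.
  near (Rstar^'+) => t.
  have : Q (A t) < 0 by apply: qF_opp_coords_lt0.
  by rewrite ltNge => /negP; apply; apply: ltW; near: t; exact: n1.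
have n1 := cvgr_lt _ (cvg_at_left_filter c) _ F0.
near (Rstar^'-) => t.
have rt : r < t by near: t; exact: nbhs_left_gt.
have [x lx hK] : exists2 x, forall j, 0 < lam j x & forall j, W x < K t j * lam j x.
  by apply: core_strict_exists => //; near: t; exact: n1.
have : Rstar <= t by apply: full_radius_le => //; exact: full_of_strict lx hK.
by rewrite leNgt => /negP; apply.
Unshelve. all: by end_near. Qed.

End Core.

(** * Connectedness and boundary of the core *)

Section Boundary.
Variables (R : realType) (v : 'I_4 -> 'rV[R]_3).
Hypothesis hv : nondegenerate_tetrahedron v.

Notation r := (circumradius (range v)).
Notation c0 := (circumcenter v).
Notation lam := (bary v).
Notation W := (cpow v).
Notation K := (opp_pow v).
Notation Q := (qF (fun j => v j - c0) r).
Notation Y := (bary_over_cpow v).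
Notation P := (point_of_coords v).
Notation A := (opp_coords v).

Let r0 : 0 < r. Proof. exact: circumradius_gt0. Qed.

Variable rho : R.
Hypothesis h : r < rho.

Notation core := (tetra_core v rho).
Notation face i := (core `&` opp_sphere v rho i).

Let rho0 : 0 < rho. Proof. exact: lt_trans h. Qed.

(** Transports [qF_path] by [point_of_coords]; sphere [i] becomes the hyperplane where coordinate
    [i] equals [A rho i]. *)
Lemma core_paths x0 x1 : Q (A rho) < 0 -> core x0 -> core x1 ->
  exists f : R -> 'rV[R]_3, [/\ f 0 = x0, f 1 = x1 &
    forall s, 0 <= s <= 1 -> [/\ core (f s), {for s, continuous f} &
      forall i, opp_sphere v rho i x0 -> opp_sphere v rho i x1 ->
                opp_sphere v rho i (f s)]].
Proof.
move=> FA c_0 c_1; have [W0 AY0 F0] := core_coords hv h c_0.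
have [W1 AY1 F1] := core_coords hv h c_1.
have [y [y_0 y_1 hy]] := qF_path (sqn_vertex hv) AY0 AY1 FA F0 F1.
have yp s : 0 <= s <= 1 -> forall j, 0 < y s j.
  by move=> /hy[_ Ay _ _] j; apply: lt_le_trans (Ay j); exact: opp_coords_gt0.
exists (fun s => P (y s)); split.
- by rewrite y_0 point_coords.
- by rewrite y_1 point_coords.
move=> s s01; have [Fs As cs fs] := hy s s01.
have S0 := coords_sum_gt0 (yp s s01).
split; first exact: core_point.
  have cS : \sum_j y t j @[t --> s] --> \sum_j y s j.
    exact: (@cvg_sumr _ _ _ _ R^o _ (fun j t => y t j)).
  have Sn : \sum_j y s j != 0 by rewrite gt_eqF.
  apply: (@cvg_sumr _ _ _ _ _ _ (fun j t => (y t j / \sum_k y t k) *: v j)) => j.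
  exact: (cvgZ (cvgM (cs j) (cvgV Sn cS)) (cvg_cst (v j))).
move=> i /(opp_sphere_coords hv _ h W0) e0 /(opp_sphere_coords hv _ h W1) e1.
apply/opp_sphere_coords => //.
  by rewrite cpow_point// ?invr_gt0//; exact: yp.
by rewrite coords_point//; [exact: fs|exact: yp].
Qed.

Lemma connected_core : Q (A rho) < 0 -> connected core.
Proof.
move=> FA; apply: (@connected_by_paths R) => x0 x1 c_0 c_1.
have [f [f0 f1 hf]] := core_paths FA c_0 c_1.
by exists f; split => // s /hf[].
Qed.

Lemma connected_core_face i : Q (A rho) < 0 -> connected (face i).
Proof.
move=> FA; apply: (@connected_by_paths R) => x0 x1 [c_0 s_0] [c_1 s_1].
have [f [f0 f1 hf]] := core_paths FA c_0 c_1.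
by exists f; split => // s /hf[cf ? sf]; split => //; split => //; exact: sf.
Qed.

Lemma opp_sphere_notin_interior i x : opp_sphere v rho i x -> ~ interior core x.
Proof.
move=> xs xi; set c := opp_center v rho i.
have nl := @near_line _ _ x (c - x) _ xi.
near (0 : R)^'+ => t.
have [_] : core (x + t *: (c - x)) by near: t; exact: nl.
apply; exists i => //; apply/eballP => //; rewrite -/c.
have -> : x + t *: (c - x) - c = (1 - t) *: (x - c).
  by rewrite addrAC scalerBl scale1r -[c - x]opprB scalerN.
have /enorm_eq -/(_ (ltW rho0)) xe := xs; rewrite sqnZ -/c xe.
have t0 : 0 < t by [].
have t1 : t < 1 by near: t; exact: nbhs_right_lt.
have r2 : 0 < rho ^+ 2 by rewrite exprn_gt0.
by rewrite gtr_pMl//; nra.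
Unshelve. all: by end_near. Qed.

(* From a point of the core close to [v k], moving in the direction [v k - v i]
   stays close to [v k] and leaves the core before reaching the facet opposite
   [v i], hence through one of the spheres. *)
Lemma vertex_closure_faces k : closure core (v k) -> (\bigcup_i closure (face i)) (v k).
Proof.
move=> vk; set C := \bigcup_i closure (face i).
have cC : closed C.
  by apply: closed_bigcup => [|i _]; [exact: finite_finset|exact: closed_closure].
rewrite (closure_id C).1// => B /nbhs_ballP[e /= e0 eB].
(* Along [v k - v i] the coordinate [lam j] is constant and [lam k] grows, so both stay positive and
   the moving point is never a vertex: [W] stays positive up to the facet opposite [v i]. *)
have [i [j [ik jk ji]]] : exists i j : 'I_4, [/\ i != k, j != k & j != i].
  exists (k + 1), (k + 2); split.
  - by rewrite -subr_eq0 addrC addKr.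
  - by rewrite -subr_eq0 addrC addKr.
  - by rewrite -subr_eq0 opprD addrACA subrr add0r.
set w := v k - v i.
have cl : lam i x * (`|w| + 1) @[x --> v k] --> lam i (v k) * (`|w| + 1).
  exact: (cvgM (@bary_continuous _ v i (v k)) (cvg_cst (`|w| + 1))).
(* The displacement will be [s *: w] with [s <= lam i x], so this keeps its norm below [e / 2]. *)
have n1 : \forall x \near v k, lam i x * (`|w| + 1) < e / 2.
  by apply: (cvgr_lt _ cl); rewrite bary_vertex// (negPf ik) mul0r divr_gt0.
have n2 : \forall x \near v k, ball (v k) (e / 2) x.
  by apply: nbhsx_ballx; rewrite divr_gt0.
have [x [xc [le xb]]] := vk _ (filterI n1 n2).
have [lx hK] := (tetra_coreP hv x h).1 xc.
have ls m s : lam m (x + s *: w) = lam m x + s * ((m == k)%:R - (m == i)%:R).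
  have := baryB v m (x + s *: w) x; rewrite [x + _ - x]addrC addKr dotZr -baryB.
  by rewrite !bary_vertex// => <-; ring.
have Wp s : 0 <= s <= lam i x -> 0 < W (x + s *: w).
  move=> /andP[s0 s1]; apply: cpow_gt0 => // [m|[m _ me]].
    rewrite ls; have lm := lx m; have [mi|mi] := eqVneq m i.
      by rewrite mi (negPf ik) sub0r mulrN mulr1 subr_ge0.
    by rewrite addr_ge0 ?(ltW lm)// subr0 mulr_ge0 ?ler0n.
  have lj : 0 < lam j (x + s *: w) by rewrite ls (negPf jk) (negPf ji) subrr mulr0 addr0.
  have lk : 0 < lam k (x + s *: w).
    by rewrite ls eqxx eq_sym (negPf ik) subr0 mulr1; have := lx k; lra.
  move: lj lk; rewrite -me !bary_vertex//.
  have [<-|] := eqVneq j m; last by rewrite ltxx.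
  by rewrite eq_sym (negPf jk) ltxx.
have cline (s : R) : x + t *: w @[t --> s] --> x + s *: w by exact: line_continuous.
pose F (m : 'I_4) (s : R) : R := K rho m * lam m (x + s *: w) - W (x + s *: w).
(* At [s = lam i x] the coordinate [lam i] vanishes, so [F i] equals minus a positive value of
   [W]. *)
have [|||s s01 [F0 [m Fm]]] := @finite_IVT R _ F (lam i x) i (ltW (lx i)).
- move=> m s; have c1 : lam m (x + t *: w) @[t --> s] --> lam m (x + s *: w).
    exact: (cvg_comp _ _ (cline s) (@bary_continuous _ v m _)).
  have c2 : W (x + t *: w) @[t --> s] --> W (x + s *: w).
    exact: (cvg_comp _ _ (cline s) (@cpow_continuous _ v _)).
  exact: (cvgB (cvgM (cvg_cst (K rho m)) c1) c2).
- by move=> m; rewrite /F scale0r addr0 subr_ge0.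
- rewrite /F ls (negPf ik) eqxx sub0r mulrN1 subrr mulr0 sub0r oppr_lt0.
  by apply: Wp; rewrite lexx ltW.
have Ws := Wp s s01.
exists (x + s *: w); split; last first.
  apply: eB; rewrite -ball_normE /= opprD addrA.
  move: xb; rewrite -ball_normE /= => xb.
  apply: le_lt_trans (ler_normB _ _) _; rewrite normrZ.
  case/andP: s01 => s0 s1; rewrite (ger0_norm s0).
  have : s * `|w| <= lam i x * (`|w| + 1) by rewrite ler_pM// lerDl.
  by lra.
exists m => //; apply: subset_closure; split; last first.
  by apply/opp_sphereP => //; apply/eqP; rewrite -subr_eq0 -/(F m s) Fm.
apply/tetra_coreP => //; split => m'; last by rewrite -subr_ge0; exact: F0.
rewrite -(pmulr_rgt0 _ (opp_pow_gt0 hv m' h)); apply: lt_le_trans Ws _.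
by rewrite -subr_ge0; exact: F0.
Qed.

(** The hulloid is closed, so the closure of the core adds at most vertices, handled by
    [vertex_closure_faces]. A core point on no sphere is interior. *)
Lemma boundary_core : boundary core = \bigcup_i closure (face i).
Proof.
apply/seteqP; split => x.
  move=> [xcl xni].
  have : hulloid rho (range v) x.
    rewrite ((closure_id _).1 (@closed_hulloid R 3 rho (range v))).
    by apply: (closure_subset _ xcl) => y; rewrite hulloidE//; right.
  rewrite hulloidE// => -[[k _ vk]|xc].
    by rewrite -vk; apply: vertex_closure_faces; rewrite vk.
  have [lx hK] := (tetra_coreP hv x h).1 xc.
  have [e|ne] := pselect (exists i, K rho i * lam i x = W x).
    have [i ei] := e; exists i => //; apply: subset_closure; split => //.
    exact/opp_sphereP.
  case: xni; apply: core_interior => // j; rewrite lt_neqAle hK andbT.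
  by apply/eqP => e; apply: ne; exists j.
move=> [i _ xi]; split; first by apply: (closure_subset _ xi) => y [].
move=> /nbhs_interior/xi[y [[_ ys] yi]].
exact: opp_sphere_notin_interior ys yi.
Qed.

End Boundary.

(** * The hulloid below, above and at the full radius *)

Theorem corollary4p9 (R : realType) (v : 'I_4 -> 'rV[R]_3)
    (hv : nondegenerate_tetrahedron v) :
  (forall rho : R, 0 < rho -> rho < full_radius (range v) ->
     hulloid rho (range v) = range v) /\
  (forall rho : R, full_radius (range v) < rho ->
     [/\ hulloid rho (range v) = range v `|` tetra_core v rho,
         connected (tetra_core v rho),
         tetra_core v rho !=set0 &
         exists S : 'I_4 -> set 'rV[R]_3,
           (forall i, connected (S i) /\ S i `<=` opp_sphere v rho i) /\
           boundary (tetra_core v rho) = \bigcup_i S i]) /\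
  (circumradius (range v) < full_radius (range v) ->
     exists O : 'rV[R]_3,
       interior (convex_hull (range v)) `&`
         \bigcap_i opp_sphere v (full_radius (range v)) i = [set O] /\
       hulloid (full_radius (range v)) (range v) = range v `|` [set O]) /\
  (full_radius (range v) = circumradius (range v) ->
     hulloid (full_radius (range v)) (range v) = range v).
Proof.
have rR := circumradius_le_full_radius hv; split; [|split; [|split]].
- move=> rho rho0 hR; have [hr|hr] := leP rho (circumradius (range v)).
    exact: hulloid_le_circumradius.
  by rewrite hulloidE// core_empty// setU0.
- move=> rho hR; have h := le_lt_trans rR hR.
  have FA := qF_opp_coords_lt0 hv hR.
  split; [exact: hulloidE|exact: connected_core| |].
    have [x lx hK] := core_strict_exists hv h FA.
    by exists x; apply/tetra_coreP => //; split => // j; exact: ltW.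
  (* Closures account for vertices in the boundary, which are outside the core; they preserve
     connectedness and stay on the closed spheres. *)
  exists (fun i => closure (tetra_core v rho `&` opp_sphere v rho i)).
  split; last exact: boundary_core.
  move=> i; split; first by apply: connected_closure; exact: connected_core_face.
  rewrite [X in _ `<=` X]((closure_id _).1 (@closed_esphere R 3 _ rho)).
  by apply: closure_subset => x [].
- move=> h; set rho := full_radius (range v) in h *.
  have FA := qF_opp_coords_full_radius hv h.
  have A0 j : 0 < opp_coords v rho j := opp_coords_gt0 hv j h.
  (* By [FA] the corner is on the quadric; equality in all four coordinates places its point on all
     four spheres. *)
  pose O := point_of_coords v (opp_coords v rho).
  have YO : bary_over_cpow v O = opp_coords v rho by apply: coords_point.
  have cO : tetra_core v rho O by apply: core_point.
  have WO : 0 < cpow v O by have [] := core_coords hv h cO.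
  have uO x : 0 < cpow v x -> bary_over_cpow v x = opp_coords v rho -> x = O.
    by move=> Wx e; rewrite -(point_coords hv Wx) e.
  exists O; split; apply/seteqP; split => x.
  + rewrite interior_convex_hull// => -[/= lx sx].
    have Wx := cpow_interior_gt0 hv lx; apply: uO => //; apply/funext => j.
    by apply/opp_sphere_coords => //; exact: sx.
  + move=> /= ->; split; first by have [] := cO.
    by move=> j _; apply/opp_sphere_coords => //; rewrite YO.
  + rewrite hulloidE// => -[|xc]; [by left|right].
    have [Wx _ _] := core_coords hv h xc.
    by have [e|] := core_dichotomy hv h xc; [exact: uO|rewrite FA ltxx].
  + by rewrite hulloidE// => -[|->]; [left|right].
- by move=> ->; apply: hulloid_le_circumradius => //; exact: circumradius_gt0.
Qed.
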